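(* Let $n\ge 1$, $\lambda>0$ and $U,V\subset\mathbb{R}^n$. Suppose $b:\mathbb{R}^n\to\mathbb{R}^n$ and $f:\mathbb{R}^n\to\mathbb{R}$ are bounded and Lipschitz continuous, and $c:U\to[0,\infty)$, $\chi:V\to[0,\infty)$ satisfy $\inf_{\xi\in U}c(\xi)>0$, $\inf_{\eta\in V}\chi(\eta)>0$, $c(\xi_1+\xi_2)\le c(\xi_1)+c(\xi_2)$ for all $\xi_1,\xi_2\in U$, and $\chi(\eta_1+\eta_2)<\chi(\eta_1)+\chi(\eta_2)$ for all $\eta_1,\eta_2\in V$. Then the lower value function $V^-$ and the upper value function $V^+$ of the two-player zero-sum deterministic impulse control game with data $(b,f,c,\chi,\lambda,U,V)$ are viscosity solutions of the classic HJBI quasi-variational inequality $$\max\Bigl\{\min\Bigl[\lambda v(x)-Dv(x)\cdot b(x)-f(x),\;v(x)-\mathcal H^c_{\sup}v(x)\Bigr],\;v(x)-\mathcal H^\chi_{\inf}v(x)\Bigr\}=0,\qquad x\in\mathbb{R}^n .$$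
   Context: Convention: in the conditions on $c$ and $\chi$, sums $\xi_1+\xi_2$ and $\eta_1+\eta_2$ are understood to lie in $U$ and $V$, so that the costs are defined there. The game. An impulse control of player-$\xi$ is a double sequence $u=(\tau_m,\xi_m)_{m\ge1}$, where $(\tau_m)$ is a non-decreasing sequence in $[0,+\infty]$ with $\tau_m\to+\infty$ and $\xi_m\in U$, $\xi_m\ne0$. An impulse control of player-$\eta$ is a double sequence $v=(\rho_k,\eta_k)_{k\ge1}$, where $(\rho_k)$ is a non-decreasing sequence in $[0,+\infty]$ with $\rho_k\to+\infty$ and $\eta_k\in V$, $\eta_k\ne0$. An impulse time $+\infty$ means that the impulse does not take place. The sets of such controls are denoted $\mathcal U$ and $\mathcal V$. Given $x\in\mathbb{R}^n$, $u\in\mathcal U$, $v\in\mathcal V$, the trajectory $y_x(\cdot)$ starts from $y_x(0)=x$ (the state before any impulse at time $0$), satisfies $\dot y_x(t)=b(y_x(t))$ for $t\ne\tau_m$, $t\ne\rho_k$, and jumps according to $$y_x(\tau_m^+)=y_x(\tau_m^-)+\xi_m\prod_{k\ge1}\mathbf 1_{\{\tau_m\ne\rho_k\}},\qquad y_x(\rho_k^+)=y_x(\rho_k^-)+\eta_k$$ (so if both players act at the same time, only the action of player-$\eta$ counts). The gain functional (maximized by player-$\xi$, minimized by player-$\eta$) is $$J(x;u,v)=\int_0^\infty f(y_x(t))e^{-\lambda t}dt-\sum_{m\ge1}c(\xi_m)e^{-\lambda\tau_m}\prod_{k\ge1}\mathbf 1_{\{\tau_m\ne\rho_k\}}+\sum_{k\ge1}\chi(\eta_k)e^{-\lambda\rho_k}.$$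 Strategies and values. $\mathcal A$ is the set of non-anticipative maps $\alpha:\mathcal V\to\mathcal U$: for all $t\ge0$ and $v_1,v_2\in\mathcal V$, if $v_1\equiv v_2$ on $[0,t]$ (same impulses at times $\le t$) then $\alpha(v_1)\equiv\alpha(v_2)$ on $[0,t]$. $\mathcal B$ is the set of non-anticipative maps $\beta:\mathcal U\to\mathcal V$, defined likewise. The value functions are $$V^-(x)=\inf_{\beta\in\mathcal B}\sup_{u\in\mathcal U}J(x;u,\beta(u)),\qquad V^+(x)=\sup_{\alpha\in\mathcal A}\inf_{v\in\mathcal V}J(x;\alpha(v),v).$$ Operators. $\mathcal H^\chi_{\inf}w(x)=\inf_{\eta\in V}[w(x+\eta)+\chi(\eta)]$ and $\mathcal H^c_{\sup}w(x)=\sup_{\xi\in U}[w(x+\xi)-c(\xi)]$. Viscosity solutions. A continuous $w:\mathbb{R}^n\to\mathbb{R}$ is a viscosity subsolution (resp. supersolution) of the classic HJBI quasi-variational inequality if for every $\bar x\in\mathbb{R}^n$ and every $\phi\in C^1(\mathbb{R}^n)$ with $w(\bar x)=\phi(\bar x)$ such that $\bar x$ is a local maximum (resp. local minimum) point of $w-\phi$, $$\max\Bigl\{\min\Bigl[\lambda w(\bar x)-D\phi(\bar x)\cdot b(\bar x)-f(\bar x),\;w(\bar x)-\mathcal H^c_{\sup}w(\bar x)\Bigr],\;w(\bar x)-\mathcal H^\chi_{\inf}w(\bar x)\Bigr\}\le0\quad(\text{resp. }\ge0).$$ It is a viscosity solution if it is both a subsolution and a supersolution. *)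

(* Defs.v *)
From HB Require Import structures.
From mathcomp Require Import all_boot all_order all_algebra.
From mathcomp Require Import all_classical all_reals all_analysis.

Set Implicit Arguments.
Unset Strict Implicit.
Unset Printing Implicit Defensive.

Import Order.TTheory GRing.Theory Num.Theory.
Import numFieldNormedType.Exports.

Local Open Scope classical_set_scope.
Local Open Scope ring_scope.

(* Vectors of R^n are row vectors, with the max norm of the library; being
   bounded, Lipschitz, continuous or C^1 does not depend on the norm.
   Sequences indexed by m >= 1 on paper are indexed by m : nat. *)

(* An impulse at time +oo does not take place, so its size is unconstrained.
   In particular the control without impulses always exists, even if S has no
   nonzero element. *)
Record control (R : realType) (n : nat) (S : set 'rV[R]_n) := Control {
  itime : nat -> \bar R ;
  isize : nat -> 'rV[R]_n ;
  itime_ge0 : forall m, (0 <= itime m)%E ;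
  itime_nondecreasing : {homo itime : m k / (m <= k)%N >-> (m <= k)%E} ;
  itime_cvgy : itime @ \oo --> +oo%E ;
  isize_in : forall m, itime m <> +oo%E -> S (isize m) ;
  isize_neq0 : forall m, itime m <> +oo%E -> isize m <> 0 }.

Section game.
Context {R : realType} {n : nat} {U V : set 'rV[R]_n}.
Implicit Types (x : 'rV[R]_n) (u : control U) (v : control V).

(* The infinite product over k of the indicators of [tau_m <> rho_k]. *)
Definition effective u v (m : nat) : bool :=
  `[< forall k, itime u m <> itime v k >].

(* y(t^+) - y(t^-). A player may act several times at the same instant, in
   which case the impulses add up; the sums are finite since the impulse times
   tend to +oo. *)
Definition jump u v (t : R) : 'rV[R]_n :=
  \sum_(m \in [set m | itime u m = t%:E]) (effective u v m)%:R *: isize u m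
  + \sum_(k \in [set k | itime v k = t%:E]) isize v k.

(* Trajectories are taken left-continuous, y(t) = y(t^-), so that y(0) = x is
   the state before any impulse at time 0. Values at negative times are
   irrelevant. *)
Definition is_trajectory (b : 'rV[R]_n -> 'rV[R]_n) x u v
    (y : R -> 'rV[R]_n) : Prop :=
  [/\ y 0 = x,
      forall t : R, 0 < t -> y s @[s --> t^'-] --> y t,
      forall t : R, 0 <= t -> y s @[s --> t^'+] --> y t + jump u v t
    & forall t : R, 0 < t ->
        (forall m, itime u m <> t%:E) -> (forall k, itime v k <> t%:E) ->
        is_derive t 1 y (b (y t))].

(* For Lipschitz b there is exactly one such trajectory on [0, +oo[. *)
Definition trajectory (b : 'rV[R]_n -> 'rV[R]_n) x u v : R -> 'rV[R]_n :=
  get [set y | is_trajectory b x u v y].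

(* [expeR (- +oo) = 0], so impulses at time +oo cost nothing.
   If both players have infinite total cost, the expression below is -oo by
   the convention on (-oo) + (+oo). This choice does not affect the values
   [lower_value] and [upper_value]: making a strategy inactive after a large
   deterministic time T changes the gain it guarantees by O(exp (- lam * T)),
   and a strategy of this kind never has infinite cost. *)
Definition gain (b : 'rV[R]_n -> 'rV[R]_n) (f : 'rV[R]_n -> R)
    (c chi : 'rV[R]_n -> R) (lam : R) x u v : \bar R :=
  (\int[lebesgue_measure]_(t in `[0%R, +oo[)
      (f (trajectory b x u v t) * expR (- lam * t))%:E
   - \sum_(0 <= m <oo) ((c (isize u m))%:E * expeR (- (lam%:E * itime u m))
                        * ((effective u v m)%:R)%:E)
   + \sum_(0 <= k <oo) ((chi (isize v k))%:E
                        * expeR (- (lam%:E * itime v k))))%E.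

End game.

(* The controls have the same impulses at times <= t. *)
Definition agree_upto (R : realType) (n : nat) (S : set 'rV[R]_n) (t : R)
    (w1 w2 : control S) : Prop :=
  forall m, (itime w1 m <= t%:E)%E \/ (itime w2 m <= t%:E)%E ->
    itime w1 m = itime w2 m /\ isize w1 m = isize w2 m.

Definition nonanticipative (R : realType) (n : nat) (S T : set 'rV[R]_n)
    (a : control S -> control T) : Prop :=
  forall (t : R) (w1 w2 : control S), 0 <= t ->
    agree_upto t w1 w2 -> agree_upto t (a w1) (a w2).

Section values.
Context {R : realType} {n : nat}.
Variables (b : 'rV[R]_n -> 'rV[R]_n) (f : 'rV[R]_n -> R).
Variables (c chi : 'rV[R]_n -> R) (lam : R) (U V : set 'rV[R]_n).

Definition lower_value (x : 'rV[R]_n) : \bar R :=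
  ereal_inf [set ereal_sup [set gain b f c chi lam x u (beta u)
                           | u in [set: control U]]
            | beta in [set beta : control U -> control V
                      | nonanticipative beta]].

Definition upper_value (x : 'rV[R]_n) : \bar R :=
  ereal_sup [set ereal_inf [set gain b f c chi lam x (alpha v) v
                           | v in [set: control V]]
            | alpha in [set alpha : control V -> control U
                       | nonanticipative alpha]].

Definition H_inf (w : 'rV[R]_n -> R) (x : 'rV[R]_n) : \bar R :=
  ereal_inf [set (w (x + eta) + chi eta)%:E | eta in V].

Definition H_sup (w : 'rV[R]_n -> R) (x : 'rV[R]_n) : \bar R :=
  ereal_sup [set (w (x + xi) - c xi)%:E | xi in U].

Definition grad (phi : 'rV[R]_n -> R) (x : 'rV[R]_n) : 'rV[R]_n :=
  \row_i 'd phi x (delta_mx 0 i).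

Definition C1 (phi : 'rV[R]_n -> R) : Prop :=
  (forall x, differentiable phi x) /\ continuous (grad phi).

Definition dotp (p q : 'rV[R]_n) : R := \sum_i p 0 i * q 0 i.

(* The left-hand side of the inequality at x, with p in place of the gradient;
   the obstacles H_sup and H_inf may be infinite. *)
Definition HJBI (w : 'rV[R]_n -> R) (p x : 'rV[R]_n) : \bar R :=
  maxe (mine (lam * w x - dotp p (b x) - f x)%:E ((w x)%:E - H_sup w x)%E)
       ((w x)%:E - H_inf w x)%E.

Definition viscosity_subsolution (w : 'rV[R]_n -> R) : Prop :=
  continuous w /\
  forall (x : 'rV[R]_n) (phi : 'rV[R]_n -> R), C1 phi -> w x = phi x ->
    (\forall z \near x, w z - phi z <= w x - phi x) ->
    (HJBI w (grad phi x) x <= 0)%E.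

Definition viscosity_supersolution (w : 'rV[R]_n -> R) : Prop :=
  continuous w /\
  forall (x : 'rV[R]_n) (phi : 'rV[R]_n -> R), C1 phi -> w x = phi x ->
    (\forall z \near x, w x - phi x <= w z - phi z) ->
    (0 <= HJBI w (grad phi x) x)%E.

Definition viscosity_solution (w : 'rV[R]_n -> R) : Prop :=
  viscosity_subsolution w /\ viscosity_supersolution w.

End values.

(* Main.v *)
(* For either value W, dynamic programming over a short time s says that W x is
   attained, up to s ^+ 2, by the gain on [0, s[ plus the discounted value of the
   state at s; player-eta may reply to a given control of player-xi, and player-xi
   may reply to an inactive player-eta. An immediate impulse of player-eta cancels
   the simultaneous ones of player-xi, whence W x <= W (x + eta) + chi eta.
   Where W is strictly below its obstacle H_inf, a reply in which player-eta acts
   before s costs too much: by subadditivity its impulses are no better than their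
   sum, and W is uniformly continuous. There player-xi can thus jump unhindered
   (so W >= H_sup), and waiting gives the supersolution inequality by a first-order
   expansion in s. Dually, where W is strictly above H_sup, player-xi cannot profit
   from acting before s against an inactive player-eta, and the same expansion gives
   the subsolution inequality. *)
Require Import Defs.
From HB Require Import structures.
From mathcomp Require Import all_boot all_order all_algebra.
From mathcomp Require Import all_classical all_reals all_analysis.
From mathcomp Require Import measurable_realfun ring lra.
Set Implicit Arguments.
Unset Strict Implicit.
Unset Printing Implicit Defensive.
Import Order.TTheory GRing.Theory Num.Theory.
Import numFieldNormedType.Exports.
Local Open Scope classical_set_scope.
Local Open Scope ring_scope.

(** * Real analysis *)

(** The two values are never compared: each is shown to have the five properties of [game_value],
    and the viscosity inequalities follow from these alone. The dynamic programming behind them is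
    proved once, for an abstract gain with one-sided bounds when one player is inactive; the upper
    value is the opposite of such a value, with the opposite gain and the players exchanged. Those
    bounds are also what makes the values finite, since the gain itself may be infinite. Time is cut
    just before [s]: impulses at [s] belong to the remaining game, whereas non-anticipation compares
    controls on closed intervals. Hence the two notions [agree_upto] and [agree_before], and the two
    counters [cntle] and [cnt]. The tolerance [s ^+ 2] serves two purposes: it is negligible against
    [s] in the first-order expansion, and eventually smaller than any fixed gap between [W] and an
    obstacle. As [trajectory] is a choice among the solutions, nothing is known of it before
    existence; uniqueness then identifies it with any function built by hand, in particular with
    shifted trajectories. *)

Section left_continuous.
Context {R : realType}.
Implicit Types h : R -> R.

(** Trajectories jump, so the running gain integrates functions that are merely left continuous, and
    only at positive times. *)
Lemma left_continuous_measurable h :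
  (forall t : R, 0 < t -> h s @[s --> t^'-] --> h t) ->
  @measurable_fun _ _ R R `[0, +oo[%classic h.
Proof.
move=> hl; apply/measurable_fun_itv_obnd_cbndP.
(* [h] is the pointwise limit of its samples at [lo k t], the largest multiple
   of [1 / k.+1] strictly below [t]. *)
pose p (k : nat) (t : R) : nat := (Num.truncn (k.+1%:R * t)).
pose lo (k : nat) (t : R) : R :=
  (if k.+1%:R * t == (p k t)%:R then (p k t).-1%:R else (p k t)%:R) / k.+1%:R.
have cell k (j : nat) t : `]j%:R / k.+1%:R, j.+1%:R / k.+1%:R]%classic t ->
    lo k t = j%:R / k.+1%:R.
  have k0 : 0 < k.+1%:R :> R by rewrite ltr0n.
  rewrite /= in_itv/= ltr_pdivrMr// ler_pdivlMr// => /andP[a1 a2].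
  rewrite /lo /p; move: a1 a2; rewrite ![t * _]mulrC; set w := _ * t => a1 a2.
  have w0 : 0 <= w by rewrite (le_trans _ (ltW a1)).
  move: (a2); rewrite le_eqVlt => /orP[/eqP we|we].
    by rewrite we natrK eqxx.
  have -> : Num.truncn w = j by apply: truncn_def; rewrite (ltW a1) we.
  by rewrite gt_eqF.
apply: (@measurable_fun_cvg _ _ _ _ (fun k t => h (lo k t))) => [k|t].
  move=> mD Y mY.
  have k0 : 0 < k.+1%:R :> R by rewrite ltr0n.
  rewrite (_ : _ `&` _ = \bigcup_(j in [set j : nat | Y (h (j%:R / k.+1%:R))])
    `]j%:R / k.+1%:R, j.+1%:R / k.+1%:R]%classic).
    by apply: bigcup_measurable => j _; exact: measurable_itv.
  apply/seteqP; split => t /=.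
    rewrite in_itv/= andbT => -[t0 Yt].
    pose w := k.+1%:R * t.
    have w0 : 0 < w by rewrite mulr_gt0.
    have := truncn_itv (ltW w0) => /andP[w1 w2].
    have [j jt] : exists j : nat, `]j%:R / k.+1%:R, j.+1%:R / k.+1%:R]%classic t.
      have [we|we] := eqVneq w (Num.truncn w)%:R.
        have tw : (0 < Num.truncn w)%N by rewrite -(ltr0n R) -we.
        exists (Num.truncn w).-1 => /=.
        rewrite in_itv/= ltr_pdivrMr// ler_pdivlMr// ![t * _]mulrC -/w prednK//.
        by rewrite -we lexx andbT [ltRHS]we ltr_nat prednK.
      exists (Num.truncn w) => /=.
      rewrite in_itv/= ltr_pdivrMr// ler_pdivlMr// ![t * _]mulrC -/w.
      by rewrite (ltW w2) andbT lt_neqAle eq_sym we.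
    by exists j => //=; rewrite -(cell _ _ _ jt).
  move=> [j Yj jt]; split; last by rewrite (cell _ _ _ jt).
  by move: jt => /=; rewrite !in_itv/= andbT => /andP[+ _]; apply: le_lt_trans.
rewrite /= in_itv/= andbT => t0.
apply: (@cvg_comp _ _ _ (lo ^~ t) h _ (t^'-)); last exact: hl.
have loP k : t - 1 / k.+1%:R <= lo k t < t.
  have k0 : 0 < k.+1%:R :> R by rewrite ltr0n.
  pose w := k.+1%:R * t.
  have w0 : 0 < w by rewrite mulr_gt0.
  have := truncn_itv (ltW w0) => /andP[w1 w2].
  rewrite /lo ltr_pdivrMr// ler_pdivlMr// mulrBl divfK ?lt0r_neq0//.
  rewrite [t * _]mulrC -/w /p -/w;  case: eqP => we.
    have tw : (0 < Num.truncn w)%N by rewrite -(ltr0n R) -we.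
    by rewrite lerBlDr natr1 [ltRHS]we ltr_nat prednK// -we lexx leqnn.
  by rewrite lerBlDr natr1 (ltW w2) lt_neqAle w1 andbT; apply/eqP => /esym.
move=> A /= [e e0 eA]; near=> k.
have /andP[l1 l2] := loP k.
apply: eA => //=.
rewrite ger0_norm ?subr_ge0 ?(ltW l2)// ltrBlDl -ltrBlDr.
apply: lt_le_trans l1; rewrite ltrD2l ltrN2 div1r.
near: k; exact: near_infty_natSinv_lt (PosNum e0).
Unshelve. all: by end_near. Qed.

End left_continuous.

(** * Integrals over half-lines: translation and exponential weights *)

Section integrals.
Context {R : realType}.
Notation mu := (@lebesgue_measure R).
Implicit Types (f h : R -> R) (lam s t : R).

Lemma measurable_addl s : measurable_fun setT (+%R s : _ -> measurableTypeR R).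
Proof. by apply: measurable_funD => //; exact: measurable_cst. Qed.

Lemma pushforward_lebesgue_addl s (A : set R) : measurable A ->
  pushforward mu (+%R s : _ -> measurableTypeR R) A = mu A.
Proof.
move=> mA; apply/esym/lebesgue_measure_unique => //=.
  exact: measurable_addl.
move=> _ _ [[a b]] _ <-.
rewrite /pushforward (_ : _ @^-1` _ = `]a - s, b - s]%classic); last first.
  by apply/seteqP; split => x /=; rewrite !in_itv/= ltrBlDl lerBrDl.
rewrite !lebesgue_measure_itv/= !lte_fin ltrD2r -!EFinB.
by case: ifP => // _; congr EFin; ring.
Qed.

Lemma integral_shift_itvcy f s :
  mu.-integrable `[s, +oo[ (EFin \o f) ->
  mu.-integrable `[0, +oo[ (EFin \o (fun t => f (s + t))) ->
  (\int[mu]_(t in `[s, +oo[) (f t)%:E = \int[mu]_(t in `[0%R, +oo[) (f (s + t)%R)%:E)%E.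
Proof.
move=> fi fsi; pose phi := (+%R s : _ -> measurableTypeR R).
have pD : phi @^-1` `[s, +oo[ = `[0, +oo[%classic.
  by apply/seteqP; split => x /=; rewrite !in_itv/= !andbT lerDl.
pose g : R -> \bar R := (EFin \o f) \_ `[s, +oo[.
have mg : measurable_fun setT g.
  by apply: (measurable_restrictT _ _).1 => //; case/integrableP: fi.
transitivity (\int[mu]_(t in `[s, +oo[) g t)%E.
  by apply: eq_integral => x xs; rewrite /g patchE xs.
transitivity (\int[pushforward mu phi]_(t in `[s, +oo[) g t)%E.
  apply: eq_measure_integral => [|? A mA _]; first exact: measurable_addl.
  exact/esym/pushforward_lebesgue_addl.
rewrite integral_pushforward// ?pD.
- apply: eq_integral => x; rewrite inE/= in_itv/= andbT => x0.
  by rewrite /g patchE mem_set//= in_itv/= andbT lerDl.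
- exact: measurable_addl.
- apply: eq_integrable fsi => // x; rewrite inE/= in_itv/= andbT => x0.
  by rewrite /g patchE mem_set//= in_itv/= andbT lerDl.
Qed.

Lemma integrableZ_itv (i : interval R) f lam : mu.-integrable [set` i] (EFin \o f) ->
  mu.-integrable [set` i] (EFin \o (fun t => lam * f t)).
Proof.
by move=> fi; apply: eq_integrable (integrableZl _ lam fi).
Qed.

Lemma le_integrable_itv (i : interval R) f h : measurable_fun [set` i] f ->
  (forall t, [set` i] t -> `|f t| <= h t) ->
  mu.-integrable [set` i] (EFin \o h) -> mu.-integrable [set` i] (EFin \o f).
Proof.
move=> mf fh; apply: le_integrable => //; first exact/measurable_EFinP.
by move=> t it /=; rewrite lee_fin (le_trans (fh t it))// ler_norm.
Qed.

Lemma continuous_expRM lam : continuous (fun t : R => expR (lam * t)).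
Proof.
move=> t; apply: continuous_comp; last exact: continuous_expR.
exact: mulrl_continuous.
Qed.

Lemma is_derive_expRM lam t :
  is_derive t 1 (fun t : R => expR (lam * t)) (lam * expR (lam * t)).
Proof.
have h : is_derive t 1 ( *%R lam) lam.
  by apply: (is_derive_eq (is_deriveZ lam (is_derive_id t 1))); rewrite /GRing.scale/= mulr1.
by apply: (is_derive_eq (is_derive1_comp (is_derive_expR _) h)); rewrite mulrC.
Qed.

Lemma integral_expRN lam : 0 < lam ->
  (\int[mu]_(t in `[0%R, +oo[) (expR (- lam * t)%R)%:E = (lam^-1)%:E)%E.
Proof.
move=> lam0.
have D t := is_derive_expRM (- lam) t.
have D2 t : is_derive t 1 (fun t => - lam^-1 * expR (- lam * t)) (expR (- lam * t)).
  apply: (is_derive_eq (is_deriveZ (- lam^-1) (D t))).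
  by rewrite /GRing.scale/= mulrA mulrNN mulVf ?gt_eqF// mul1r.
rewrite (@ge0_continuous_FTC2y _ _ (fun t => - lam^-1 * expR (- lam * t)) 0 0).
- by rewrite mulr0 expR0 mulr1 -EFinB sub0r opprK.
- by move=> t _; exact: expR_ge0.
- by apply: continuous_subspaceT; exact: continuous_expRM.
- rewrite -[X in _ --> X](mulr0 (- lam^-1)); apply: cvgM; first exact: cvg_cst.
  rewrite (_ : (fun x => expR (- lam * x)) =
               (fun z => expR (- z)) \o (fun z => lam * z)); last first.
    by apply: eq_fun => x; rewrite mulNr.
  apply: (@cvg_comp _ _ _ _ _ _ (pinfty_nbhs R)); last exact: cvgr_expR.
  exact: gt0_cvgMry.
- by move=> t _; have [] := D2 t.
- apply: cvg_at_right_filter; apply: cvgM; first exact: cvg_cst.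
  exact: continuous_expRM.
- by move=> t _; rewrite derive1E derive_val.
Qed.

Lemma integrable_expRN lam : 0 < lam ->
  mu.-integrable `[0, +oo[ (EFin \o (fun t => expR (- lam * t))).
Proof.
move=> lam0; apply/integrableP; split.
  apply/measurable_EFinP/measurable_funTS.
  by apply: continuous_measurable_fun; exact: continuous_expRM.
under eq_integral do rewrite /= ger0_norm ?expR_ge0//.
by rewrite integral_expRN// ltry.
Qed.

Lemma Rintegral_expRN_le (lam A : R) h : 0 < lam ->
  mu.-integrable `[0, +oo[ (EFin \o h) -> (forall t, 0 <= t -> `|h t| <= A * expR (- lam * t)) ->
  `|\int[mu]_(t in `[0, +oo[) h t| <= A / lam.
Proof.
move=> lam0 ih hA; apply: le_trans (le_normr_Rintegral _ ih) _ => //.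
have -> : A / lam = \int[mu]_(t in `[0, +oo[) (A * expR (- lam * t)).
  rewrite RintegralZl//; last exact: integrable_expRN.
  by rewrite /Rintegral integral_expRN.
apply: le_Rintegral => //.
- exact: integrable_norm.
- by apply: integrableZ_itv; exact: integrable_expRN.
- by move=> t; rewrite /= in_itv/= andbT; exact: hA.
Qed.

End integrals.

Section row_vectors.
Context {R : realType} {n : nat}.
Implicit Types (D : R -> 'rV[R]_n) (v : 'rV[R]_n) (t : R).

Lemma ler_norm_entry v i : `|v 0 i| <= `|v|.
Proof.
rewrite [leRHS]/Num.Def.normr/= mx_normrE.
exact: (le_bigmax _ (fun i => `|v i.1 i.2|) (ord0, i)).
Qed.

Lemma row_norm_le v c : 0 <= c -> (forall i, `|v 0 i| <= c) -> `|v| <= c.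
Proof.
move=> c0 vc; rewrite [leLHS]/Num.Def.normr/= mx_normrE.
by apply: bigmax_le => // -[i j] _ /=; rewrite ord1.
Qed.

Lemma sqr_norm_le_sum v : `|v| ^+ 2 <= \sum_i v 0 i ^+ 2.
Proof.
rewrite (_ : `|v| = mx_norm v)//; have [v0|v0] := eqVneq (mx_norm v) 0.
  by rewrite v0 expr0n/= sumr_ge0// => i _; exact: sqr_ge0.
have [[i j] /= ->] := mx_norm_neq0 v0.
rewrite ord1 real_normK ?num_real// (bigD1 j)//= lerDl.
by apply: sumr_ge0 => k _; exact: sqr_ge0.
Qed.

Lemma is_derive_entry D t v i : is_derive t 1 D v ->
  is_derive t 1 (fun s => D s 0 i) (v 0 i).
Proof.
move=> [dD Dv]; apply: DeriveDef; first exact: (derivable_mxP _ _ _).1.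
by rewrite -Dv derive_mx// mxE.
Qed.

Lemma is_derive_row D t v :
  (forall i, is_derive t 1 (fun s => D s 0 i) (v 0 i)) -> is_derive t 1 D v.
Proof.
move=> Dv; have dD : derivable D t 1.
  by apply/derivable_mxP => i j; rewrite ord1; have [] := Dv j.
apply: DeriveDef => //; rewrite derive_mx//; apply/rowP => i; rewrite mxE.
by have [] := Dv i.
Qed.

End row_vectors.

Section gronwall.
Context {R : realType}.

(** Induction on the list of exceptional points, splitting the interval at each one lying inside. In
    the application these are impulse times, where a difference of trajectories is continuous but
    may fail to be differentiable. *)
Lemma nonincreasing_off_seq (g : R -> R) (s : seq R) (a b : R) : a <= b ->
  {within `[a, b], continuous g} ->
  (forall t, a < t < b -> t \notin s ->
    exists2 d, is_derive t 1 g d & d <= 0) ->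
  g b <= g a.
Proof.
elim: s a b => [|p s IH] a b ab cg dg.
  have inab t : t \in `]a, b[ -> derivable g t 1 /\ (g^`())%classic t <= 0.
    rewrite in_itv/= => tab; have [//|d gd d0] := dg t tab.
    by split; [have [] := gd|rewrite derive1E derive_val].
  apply: (@ler0_derive1_le_cc _ g a b) => //; rewrite ?in_itv/= ?lexx ?ab//.
  - by move=> x /inab[].
  - by move=> x /inab[].
have sub c d : a <= c -> d <= b -> {within `[c, d], continuous g}.
  move=> ac db; apply: continuous_subspaceW cg => x /=.
  by rewrite !in_itv/= => /andP[cx xd]; rewrite (le_trans ac)// (le_trans xd).
have [/andP[ap pb]|pab] := boolP (a < p < b).
  apply: (@le_trans _ _ (g p)); apply: IH => //; try exact: ltW; try exact: sub.
  - by apply: sub => //; exact: ltW.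
  - move=> t /andP[pt tb] ts; apply: dg; first by rewrite (lt_trans ap).
    by rewrite inE negb_or gt_eqF.
  - by apply: sub => //; exact: ltW.
  - move=> t /andP[ta tp] ts; apply: dg; first by rewrite ta (lt_trans tp).
    by rewrite inE negb_or lt_eqF.
apply: IH => // t tab ts; apply: dg => //.
by rewrite inE negb_or ts andbT; apply: contra pab => /eqP <-.
Qed.

Lemma gronwall (n : nat) (D D' : R -> 'rV[R]_n) (L T : R) (s : seq R) :
  0 <= T -> 0 <= L -> {within `[0, T], continuous D} ->
  (forall t, 0 < t < T -> t \notin s ->
     is_derive t 1 D (D' t) /\ `|D' t| <= L * `|D t|) ->
  `|D T| ^+ 2 <= n%:R * expR (2 * n%:R * L * T) * `|D 0| ^+ 2.
Proof.
move=> T0 L0 cD dD; pose K := 2 * n%:R * L.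
pose E t := \sum_i (D t 0 i) ^+ 2.
pose g t := E t * expR (- K * t).
have gT0 : g T <= g 0.
  apply: (@nonincreasing_off_seq _ s) => //.
    rewrite /g /E => x; apply: cvgM; last first.
      exact: (continuous_subspaceT (@continuous_expRM R (- K))).
    apply: cvg_big => [|i _]; first exact: add_continuous.
    apply: (@cvg_comp _ _ _ (fun t => D t 0 i) (fun r => r ^+ 2) _ (nbhs (D x 0 i))).
      apply: (@cvg_comp _ _ _ D (fun v => v 0 i) _ (nbhs (D x))); first exact: cD.
      exact: coord_continuous.
    exact: exprn_continuous.
  move=> t tT ts; have [dt D't] := dD t tT ts.
  have dE : is_derive t 1 E (\sum_i 2 * D t 0 i * D' t 0 i).
    rewrite /E (_ : (fun t => _) = \sum_i (fun t => D t 0 i ^+ 2)); last first.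
      by apply/funext => x; rewrite fct_sumE.
    apply: is_derive_sum => i.
    pose Di : R -> R := fun t => D t 0 i.
    have dDi : is_derive t 1 Di (D' t 0 i) by exact: is_derive_entry.
    rewrite (_ : (fun t => _) = Di * Di); last first.
      by apply/funext => x; rewrite expr2.
    apply: is_derive_eq; rewrite -[D t 0 i]/(Di t) /GRing.scale/=.
    by rewrite -mulrA mulr_natl mulr2n.
  have dg : is_derive t 1 g ((\sum_i 2 * D t 0 i * D' t 0 i - K * E t) * expR (- K * t)).
    apply: (is_derive_eq (is_deriveM dE (is_derive_expRM (- K) t))).
    by rewrite /GRing.scale/=; ring.
  exists ((\sum_i 2 * D t 0 i * D' t 0 i - K * E t) * expR (- K * t)) => //.
  apply: mulr_le0_ge0; last exact: expR_ge0.
  rewrite subr_le0 (@le_trans _ _ (K * `|D t| ^+ 2))//; last first.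
    by rewrite ler_wpM2l ?sqr_norm_le_sum// /K !mulr_ge0.
  rewrite (@le_trans _ _ (\sum_(i < n) 2 * L * `|D t| ^+ 2))//.
    apply: ler_sum => i _; rewrite (le_trans (ler_norm _))// !normrM normr_nat.
    rewrite expr2 -!mulrA ler_wpM2l// mulrCA ler_pM// ?ler_norm_entry//.
    exact: le_trans (ler_norm_entry _ _) _.
  by rewrite sumr_const card_ord -mulr_natl /K; lra.
have : E T <= E 0 * expR (K * T).
  rewrite -ler_pdivrMr ?expR_gt0// -expRN -mulNr.
  by move: gT0; rewrite /g mulr0 expR0 mulr1.
move=> ET; rewrite (le_trans (sqr_norm_le_sum _))// (le_trans ET)//.
rewrite [leRHS]mulrAC -/K ler_wpM2r ?expR_ge0//.
rewrite mulr_natl -[X in _ *+ X]card_ord -sumr_const; apply: ler_sum => i _.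
by rewrite -real_normK ?num_real// ler_sqr ?nnegrE// ler_norm_entry.
Qed.

End gronwall.

Section primitive.
Context {R : realType}.
Notation mu := (@lebesgue_measure R).
Implicit Types (h : R -> R) (M t : R).

Definition left_continuous_gt0 {T : topologicalType} (h : R -> T) :=
  forall t : R, 0 < t -> h s @[s --> t^'-] --> h t.

Lemma lebesgue_measure_itv_fin (a b : bool) (x y : R) :
  (mu [set` Interval (BSide a x) (BSide b y)] < +oo)%E.
Proof.
rewrite lebesgue_measure_itv/=; case: ifP => _; last exact: ltry.
by rewrite -EFinB ltry.
Qed.

Lemma integrable_left_continuous h M t (b : bool) : left_continuous_gt0 h ->
  (forall s, `|h s| <= M) ->
  mu.-integrable [set` Interval (BLeft 0) (BSide b t)] (EFin \o h).
Proof.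
move=> hl hM.
have mh : measurable_fun [set` Interval (BLeft 0) (BSide b t)] h.
  apply: (measurable_funS _ _ (left_continuous_measurable hl)) => //.
  by move=> x /=; rewrite !in_itv/= andbT; case: b => /andP[].
apply: measurable_bounded_integrable => //.
- exact: lebesgue_measure_itv_fin.
- by exists M; split; [exact: num_real|move=> N MN x _; exact: le_trans (hM x) (ltW MN)].
Qed.

Lemma norm_Rintegral_le (A : set R) h M : measurable A ->
  mu.-integrable A (EFin \o h) -> (mu A < +oo)%E ->
  (forall s, A s -> `|h s| <= M) ->
  `|\int[mu]_(s in A) h s| <= M * fine (mu A).
Proof.
move=> mA hi Afin hM; apply: le_trans; first exact: le_normr_Rintegral.
rewrite -Rintegral_cst//; apply: le_Rintegral => //.
- exact: (integrable_norm hi).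
- apply: measurable_bounded_integrable => //.
  by exists `|M|; split; [exact: num_real|move=> N MN x _; rewrite ltW].
Qed.

(** For negative [t] the interval is empty and the primitive vanishes, so the Picard iterates are
    defined and Lipschitz on the whole line. *)
Definition primitive h t := \int[mu]_(s in `[0, t]) h s.

Lemma primitive_le0 h t : t <= 0 -> primitive h t = 0.
Proof.
rewrite le_eqVlt => /predU1P[->|t0].
  by rewrite /primitive set_itv1 Rintegral_set1.
by rewrite /primitive set_itv_ge ?Rintegral_set0// bnd_simp -ltNge.
Qed.

Lemma primitive_lipschitz h M : left_continuous_gt0 h ->
  (forall s, `|h s| <= M) ->
  forall s t, `|primitive h s - primitive h t| <= M * `|s - t|.
Proof.
move=> hl hM s t; have M0 : 0 <= M by rewrite (le_trans _ (hM 0)).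
wlog st : s t / s <= t.
  move=> W; have [/W//|/ltW/W] := leP s t.
  by rewrite distrC [X in _ <= _ * X -> _]distrC.
have lip (a b : R) : 0 <= a <= b -> `|primitive h b - primitive h a| <= M * (b - a).
  move=> /andP[a0 ab]; rewrite /primitive Rintegral_itvB//; last first.
    exact: (integrable_left_continuous b false hl hM).
  have mab : mu `]a, b] = (b - a)%:E.
    rewrite lebesgue_measure_itv/= lte_fin; case: ltP => // ba.
    by rewrite (@le_anti _ _ a b) ?subrr// ab ba.
  rewrite -[b - a]/(fine (b - a)%:E) -mab; apply: norm_Rintegral_le => //.
  - apply: integrableS (integrable_left_continuous b false hl hM) => //.
    by apply: subset_itvr; rewrite bnd_simp.
  - by rewrite mab ltry.
rewrite [leLHS]distrC [`|s - t|]distrC [`|t - s|]ger0_norm ?subr_ge0//.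
have [s0|s0] := leP 0 s; first by apply: lip; rewrite s0.
rewrite (primitive_le0 h (ltW s0)) subr0.
have [t0|t0] := leP 0 t.
  have := lip 0 t; rewrite lexx t0 (primitive_le0 h (lexx 0)) !subr0 => /(_ isT).
  by move=> /le_trans; apply; rewrite ler_wpM2l// lerDl oppr_ge0 ltW.
by rewrite (primitive_le0 h (ltW t0)) normr0 mulr_ge0// subr_ge0.
Qed.

Lemma is_derive_primitive h M t : left_continuous_gt0 h ->
  (forall s, `|h s| <= M) -> 0 < t -> {for t, continuous h} ->
  is_derive t 1 (primitive h) (h t).
Proof.
move=> hl hM t0 ht.
have [||dF F'] := @continuous_FTC1_closed R h 0 t (t + 1) _ _ t0 ht.
- by rewrite ltrDl.
- exact: (integrable_left_continuous (t + 1) false hl hM).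
- by apply: DeriveDef => //; rewrite -derive1E.
Qed.

Lemma primitive_dist h1 h2 M (g : R -> R) t :
  left_continuous_gt0 h1 -> left_continuous_gt0 h2 -> continuous g ->
  (forall s, `|h1 s| <= M) -> (forall s, `|h2 s| <= M) ->
  (forall s, 0 <= s <= t -> `|h1 s - h2 s| <= g s) ->
  `|primitive h1 t - primitive h2 t| <= \int[mu]_(s in `[0, t]) g s.
Proof.
move=> l1 l2 cg M1 M2 hg.
have i1 := integrable_left_continuous t false l1 M1.
have i2 := integrable_left_continuous t false l2 M2.
have i12 : mu.-integrable `[0, t] (EFin \o (fun s => h1 s - h2 s)).
  by apply: eq_integrable (integrableB _ i1 i2) => // x _ /=; rewrite EFinB.
rewrite /primitive -RintegralB//.
apply: (le_trans (le_normr_Rintegral _ i12)) => //.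
apply: le_Rintegral => //.
- exact: (integrable_norm i12).
- apply: continuous_compact_integrable; first exact: segment_compact.
  exact: continuous_subspaceT.
Qed.

Lemma Rintegral_expR_le (K A t : R) : 0 < K -> 0 <= A -> 0 <= t ->
  \int[mu]_(s in `[0, t]) (A * expR (K * s)) <= A / K * expR (K * t).
Proof.
move=> K0 A0; rewrite le_eqVlt => /predU1P[<-|t0].
  by rewrite set_itv1 Rintegral_set1 !mulr_ge0 ?expR_ge0// invr_ge0 ltW.
have D2 (s : R) : is_derive s 1 (fun s => A / K * expR (K * s)) (A * expR (K * s)).
  apply: (is_derive_eq (is_deriveZ (A / K) (is_derive_expRM K s))).
  by rewrite /GRing.scale/= mulrA divfK ?gt_eqF.
have cA (B : R) : continuous (fun s : R => B * expR (K * s)).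
  by move=> x; apply: cvgM; [exact: cvg_cst|exact: continuous_expRM].
rewrite /Rintegral (@continuous_FTC2 _ _ (fun s => A / K * expR (K * s)))//.
- rewrite -EFinB/= mulr0 expR0 mulr1 gerBl divr_ge0// ltW//.
- by apply: continuous_subspaceT; exact: cA.
- split.
  + by move=> x _; have [] := D2 x.
  + by apply: cvg_at_right_filter; exact: cA.
  + by apply: cvg_at_left_filter; exact: cA.
- by move=> x _; rewrite derive1E derive_val.
Qed.

End primitive.

Section geometric.
Context {R : realType}.

Lemma ler_geometric_limit (x y c : R) :
  (forall k : nat, x <= y + c / 2 ^+ k) -> x <= y.
Proof.
move=> xyc; rewrite leNgt; apply/negP => yx.
have d0 : 0 < x - y by rewrite subr_gt0.
pose k := Num.truncn (c / (x - y)).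
have kc : c / (x - y) < k.+1%:R by exact: truncnS_gt.
have k2 : k.+1%:R <= 2 ^+ k :> R by rewrite -natrX ler_nat ltn_expl.
have := xyc k; rewrite -lerBlDl ler_pdivlMr ?exprn_gt0// leNgt => /negP; apply.
rewrite mulrC -ltr_pdivrMr//; exact: lt_le_trans k2.
Qed.

(** In each coordinate the intervals from [lo i k] to [up i k] are nested, because their half-length
    [2 * c / 2 ^+ k] exceeds the next one by exactly the allowed step. The supremum of the left ends
    is the limit, with an explicit rate. *)
Lemma geometric_limit (n : nat) (u : nat -> 'rV[R]_n) (c : R) :
  (forall k, `|u k.+1 - u k| <= c / 2 ^+ k) ->
  exists l, forall k, `|l - u k| <= 2 * c / 2 ^+ k.
Proof.
move=> uc; have c0 : 0 <= c by have := uc 0%N; rewrite expr0 divr1; exact: le_trans.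
have half k : 2 * c / 2 ^+ k.+1 = c / 2 ^+ k.
  by rewrite exprS -mulf_div divff ?mul1r// pnatr_eq0.
have dbl k : 2 * c / 2 ^+ k = c / 2 ^+ k + c / 2 ^+ k.
  by rewrite -mulrA mulr_natl mulr2n.
have d0 k : 0 <= c / 2 ^+ k by rewrite divr_ge0// exprn_ge0.
pose lo i k := u k 0 i - 2 * c / 2 ^+ k.
pose up i k := u k 0 i + 2 * c / 2 ^+ k.
have step i k : `|u k.+1 0 i - u k 0 i| <= c / 2 ^+ k.
  by rewrite (le_trans _ (uc k))// (le_trans _ (ler_norm_entry _ i))// !mxE.
have lo1 i k : lo i k <= lo i k.+1.
  by rewrite /lo half dbl; have := step i k; rewrite ler_norml => /andP[]; lra.
have up1 i k : up i k.+1 <= up i k.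
  by rewrite /up half dbl; have := step i k; rewrite ler_norml => /andP[]; lra.
have lo_homo i : {homo lo i : k m / (k <= m)%N >-> k <= m}.
  by apply: homo_leq => //; exact: le_trans.
have up_homo i k m : (k <= m)%N -> up i m <= up i k.
  move=> km; have := @homo_leq R (up i) (fun a b => b <= a) (fun _ => lexx _) _ (up1 i) k m km.
  by apply => y x z xy yz; exact: le_trans yz xy.
have loup i k m : lo i k <= up i m.
  have lu j : lo i j <= up i j by rewrite /lo /up dbl; have := d0 j; lra.
  rewrite (le_trans (lo_homo i _ _ (leq_maxl k m)))// (le_trans (lu _))//.
  exact: up_homo (leq_maxr k m).
exists (\row_i sup (range (lo i))) => k.
apply: row_norm_le => [|i]; first by rewrite dbl addr_ge0.
rewrite !mxE ler_norml.
have hs : has_sup (range (lo i)).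
  split; first by exists (lo i 0%N), 0%N.
  by exists (up i 0%N) => _ [m _ <-]; exact: loup.
have h1 : lo i k <= sup (range (lo i)) by apply: ub_le_sup; [case: hs|exists k].
have h2 : sup (range (lo i)) <= up i k.
  by apply: ge_sup; [case: hs|move=> _ [m _ <-]; exact: loup].
by move: h1 h2; rewrite /lo /up; lra.
Qed.

End geometric.

Lemma lipschitz_continuous {R : realType} (A B : normedModType R) (g : A -> B) K :
  (forall s t, `|g s - g t| <= K * `|s - t|) -> continuous g.
Proof.
move=> gK t; apply/(@cvgrPdist_le _ _ _ (nbhs t)) => e e0.
have K1 : 0 < `|K| + 1 by rewrite ltr_wpDl.
near=> s; rewrite (le_trans (gK _ _))// (@le_trans _ _ ((`|K| + 1) * `|t - s|))//.
  by rewrite ler_wpM2r// (le_trans (ler_norm K))// lerDl.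
rewrite mulrC -ler_pdivlMr//.
near: s; apply: cvgr_dist_le; first exact: cvg_id.
by rewrite divr_gt0.
Unshelve. all: by end_near. Qed.

(** * Trajectories *)

(* Picard iteration for [z t + J t], where [J] gathers the past jumps, so that
   [z] is continuous. *)
Section picard.
Context {R : realType} {n : nat}.
Variables (b : 'rV[R]_n -> 'rV[R]_n) (M L : R) (x : 'rV[R]_n).
Variable J : R -> 'rV[R]_n.
Hypotheses (L0 : 0 < L) (bM : forall y, `|b y| <= M)
  (bL : forall y z, `|b y - b z| <= L * `|y - z|)
  (Jl : left_continuous_gt0 J).

Let field (z : R -> 'rV[R]_n) (i : 'I_n) (s : R) : R := b (z s + J s) 0 i.

Let step (z : R -> 'rV[R]_n) (t : R) : 'rV[R]_n := x + \row_i primitive (field z i) t.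

Lemma field_cvg (F : set_system R) {FF : Filter F} (z : R -> 'rV[R]_n) i t :
  z s @[s --> F] --> z t -> J s @[s --> F] --> J t ->
  field z i s @[s --> F] --> field z i t.
Proof.
move=> zF JF.
apply: (@cvg_comp _ _ _ (fun s => b (z s + J s)) (fun v => v 0 i) _ (nbhs (b (z t + J t)))).
  apply: (@cvg_comp _ _ _ (fun s => z s + J s) b _ (nbhs (z t + J t))).
    exact: cvgD.
  exact: lipschitz_continuous bL _.
exact: coord_continuous.
Qed.

Lemma field_left_continuous z i : continuous z -> left_continuous_gt0 (field z i).
Proof.
move=> zc t t0; apply: field_cvg; last exact: Jl.
by apply: cvg_at_left_filter; exact: zc.
Qed.

Lemma field_le z i s : `|field z i s| <= M.
Proof. by rewrite (le_trans (ler_norm_entry _ _)). Qed.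

Lemma M_ge0 : 0 <= M.
Proof. exact: le_trans (bM x). Qed.

Lemma stepBE z w s t i :
  (step z s - step w t) 0 i = primitive (field z i) s - primitive (field w i) t.
Proof. by rewrite !mxE opprD addrACA subrr add0r. Qed.

Lemma step_lipschitz z s t : continuous z ->
  `|step z s - step z t| <= M * `|s - t|.
Proof.
move=> zc; apply: row_norm_le => [|i]; first by rewrite mulr_ge0// M_ge0.
rewrite stepBE; apply: primitive_lipschitz => [|r]; last exact: field_le.
exact: field_left_continuous.
Qed.

Lemma step_le0 z t : t <= 0 -> step z t = x.
Proof.
by move=> t0; apply/rowP => i; rewrite !mxE primitive_le0// addr0.
Qed.

(** The weight [expR (2 * L * t)] makes the integral operator halve distances at all times at once:
    the integral of [L * A * expR (2 * L * s)] up to [t] is at most [A / 2 * expR (2 * L * t)]. No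
    restriction to short times is needed. *)
Lemma step_contraction z w A : continuous z -> continuous w -> 0 <= A ->
  (forall t, `|z t - w t| <= A * expR (2 * L * t)) ->
  forall t : R, `|step z t - step w t| <= A / 2 * expR (2 * L * t).
Proof.
move=> zc wc A0 zw t; have rhs0 : 0 <= A / 2 * expR (2 * L * t).
  by rewrite !mulr_ge0// expR_ge0.
have [t0|t0] := ltP t 0; first by rewrite !(step_le0 _ (ltW t0)) subrr normr0.
apply: row_norm_le => // i; rewrite stepBE.
have -> : A / 2 * expR (2 * L * t) = (L * A) / (2 * L) * expR (2 * L * t).
  by congr (_ * _); rewrite -mulf_div mulrC; field; rewrite gt_eqF.
apply: le_trans (Rintegral_expR_le _ _ _) => //; last 2 first.
- by rewrite mulr_gt0.
- by rewrite mulr_ge0// ltW.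
apply: (@primitive_dist _ _ _ M).
- exact: field_left_continuous.
- exact: field_left_continuous.
- by move=> s; apply: cvgM; [exact: cvg_cst|exact: continuous_expRM].
- by move=> s; exact: field_le.
- by move=> s; exact: field_le.
move=> s _; rewrite (@le_trans _ _ `|b (z s + J s) - b (w s + J s)|)//.
  by rewrite (le_trans _ (ler_norm_entry _ i))// !mxE.
rewrite (le_trans (bL _ _))// -mulrA ler_pM2l//.
by rewrite opprD addrACA subrr addr0.
Qed.

Lemma picard : exists z : R -> 'rV[R]_n,
  [/\ z 0 = x,
      forall s t, `|z s - z t| <= M * `|s - t|
    & forall t, 0 < t -> {for t, continuous J} ->
        is_derive t 1 z (b (z t + J t))].
Proof.
pose zk k := iter k step (fun=> x).
have zkL k s t : `|zk k s - zk k t| <= M * `|s - t|.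
  elim: k s t => [|k IH] s t; first by rewrite /= subrr normr0 mulr_ge0// M_ge0.
  by apply: step_lipschitz; exact: lipschitz_continuous.
have zkc k : continuous (zk k) by apply: lipschitz_continuous; exact: zkL.
(* The first iterate moves by at most [M * t = A * (2 * L * t)], which is below
   [A * expR (2 * L * t)]. *)
pose A := M / (2 * L); have A0 : 0 <= A by rewrite divr_ge0 ?M_ge0// mulr_ge0// ltW.
have zkS k t : `|zk k.+1 t - zk k t| <= A / 2 ^+ k * expR (2 * L * t).
  elim: k t => [|k IH] t.
    rewrite expr0 divr1 /=; have [t0|t0] := leP t 0.
      by rewrite step_le0// subrr normr0 mulr_ge0// expR_ge0.
    have := @step_lipschitz (fun=> x) t 0 (zkc 0%N).
    rewrite (@step_le0 _ 0)// subr0 gtr0_norm// => /le_trans; apply.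
    have -> : M * t = A * (2 * L * t).
      by rewrite /A; field; rewrite gt_eqF.
    rewrite ler_wpM2l// (le_trans _ (expR_ge1Dx _))//.
    by rewrite lerDr.
  have -> : A / 2 ^+ k.+1 = A / 2 ^+ k / 2 by rewrite exprSr invfM mulrA.
  by apply: (step_contraction (zkc k.+1) (zkc k) _ IH); rewrite divr_ge0// exprn_ge0.
have /choice[z zP] : forall t : R, exists l : 'rV[R]_n, forall k : nat,
    `|l - zk k t| <= 2 * (A * expR (2 * L * t)) / 2 ^+ k.
  move=> t; apply: geometric_limit => k.
  by rewrite mulrAC.
have zM s t : `|z s - z t| <= M * `|s - t|.
  apply: (@ler_geometric_limit _ _ _ (2 * (A * expR (2 * L * s)) + 2 * (A * expR (2 * L * t)))) => k.
  have -> : z s - z t = (z s - zk k s) + (zk k s - zk k t) + (zk k t - z t).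
    by rewrite !subrKA.
  rewrite mulrDl [leRHS]addrA [M * _ + _]addrC (le_trans (ler_normD _ _))// lerD//.
    by rewrite (le_trans (ler_normD _ _))// lerD.
  by rewrite distrC.
have zc : continuous z by exact: lipschitz_continuous.
(* Both sides are within a geometrically small distance of [zk k.+1 t]: the left one by contraction,
   the right one by the choice of [z]. *)
have stepz t : step z t = z t.
  apply/eqP; rewrite -subr_eq0 -normr_le0.
  apply: (@ler_geometric_limit _ _ _ (A * expR (2 * L * t) + (A * expR (2 * L * t)))) => k.
  rewrite add0r -(subrKA (zk k.+1 t)) (le_trans (ler_normD _ _))// mulrDl lerD//.
    have := @step_contraction z (zk k) (2 * A / 2 ^+ k) zc (zkc k) _ _ t.
    rewrite (_ : 2 * A / 2 ^+ k / 2 * expR (2 * L * t) = A * expR (2 * L * t) / 2 ^+ k); last first.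
      by field; rewrite expf_neq0.
    apply; first by apply: divr_ge0; [exact: mulr_ge0|exact: exprn_ge0].
    move=> s; have := zP s k.
    by rewrite (_ : 2 * (A * _) / _ = 2 * A / 2 ^+ k * expR (2 * L * s)) //; field; rewrite expf_neq0.
  rewrite distrC; have := zP t k.+1.
  by rewrite (_ : 2 * (A * _) / _ = A * expR (2 * L * t) / 2 ^+ k) //; rewrite exprS; field; rewrite expf_neq0.
exists z; split => //; first by rewrite -stepz step_le0.
move=> t t0 Jt; apply: is_derive_row => i.
rewrite (_ : (fun s => z s 0 i) = (fun=> x 0 i) + primitive (field z i)); last first.
  by apply/funext => s; rewrite -[in LHS]stepz !mxE.
have -> : b (z t + J t) 0 i = 0 + field z i t by rewrite add0r.
apply: is_deriveD; apply: (@is_derive_primitive _ _ M) => //.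
- exact: field_left_continuous.
- by move=> s; exact: field_le.
- by apply: field_cvg => //; exact: zc.
Qed.

End picard.

(** * Counting the impulses before a given time *)

Section counting.
Context {R : realType} {n : nat} {S : set 'rV[R]_n}.
Implicit Types (w : control S) (s t : R).

Lemma control_ext w1 w2 : itime w1 = itime w2 -> isize w1 = isize w2 -> w1 = w2.
Proof.
case: w1 w2 => [t1 s1 a1 b1 c1 d1 e1] [t2 s2 a2 b2 c2 d2 e2] /= tE sE.
subst; congr Control; exact: Prop_irrelevance.
Qed.

Lemma itime_unbounded w t : exists N, (t%:E < itime w N)%E.
Proof.
have /cvgeyPgt /(_ t) [N _ Nw] := itime_cvgy w.
by exists N; apply: Nw => /=.
Qed.

Lemma itime_unbounded_le w t : exists N, (t%:E <= itime w N)%E.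
Proof. by have [N /ltW] := itime_unbounded w t; exists N. Qed.

(** The first index whose impulse is not before [t]; as the times are nondecreasing, this is the
    number of impulses strictly before [t]. The variant [cntle] also counts those at [t]. *)
Definition cnt w t : nat := ex_minn (itime_unbounded_le w t).
Definition cntle w t : nat := ex_minn (itime_unbounded w t).

Lemma ltn_cnt w t m : (m < cnt w t)%N = (itime w m < t%:E)%E.
Proof.
rewrite /cnt; case: ex_minnP => N tN minN; rewrite [RHS]ltNge.
apply/idP/idP => [mN|]; first by apply: contraL mN => /minN; rewrite -leqNgt.
by apply: contraNltn => Nm; rewrite (le_trans tN)// itime_nondecreasing.
Qed.

Lemma ltn_cntle w t m : (m < cntle w t)%N = (itime w m <= t%:E)%E.
Proof.
rewrite /cntle; case: ex_minnP => N tN minN; rewrite [RHS]leNgt.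
apply/idP/idP => [mN|]; first by apply: contraL mN => /minN; rewrite -leqNgt.
by apply: contraNltn => Nm; rewrite (lt_le_trans tN)// itime_nondecreasing.
Qed.

Lemma cnt_le_cntle w t : (cnt w t <= cntle w t)%N.
Proof.
by rewrite leqNgt; apply/negP; rewrite ltn_cnt => /ltW; rewrite -ltn_cntle ltnn.
Qed.

Lemma cnt_homo w s t : s <= t -> (cnt w s <= cnt w t)%N.
Proof.
move=> st; rewrite leqNgt; apply/negP; rewrite ltn_cnt => wt.
have : (itime w (cnt w t) < t%:E)%E by rewrite (lt_le_trans wt).
by rewrite -ltn_cnt ltnn.
Qed.

Lemma cnt_le0 w t : t <= 0 -> cnt w t = 0%N.
Proof.
move=> t0; apply/eqP; rewrite -leqn0 leqNgt ltn_cnt -leNgt.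
by rewrite (@le_trans _ _ 0%E) ?itime_ge0.
Qed.

Lemma cnt_at_left w t : \forall s \near t^'-, cnt w s = cnt w t.
Proof.
case Nt : (cnt w t) => [|N].
  near=> s; apply/eqP; rewrite -leqn0 -Nt; apply: cnt_homo; apply: ltW.
  by near: s; exact: nbhs_left_lt.
have : (itime w N < t%:E)%E by rewrite -ltn_cnt Nt.
have := itime_ge0 w N; case wN : (itime w N) => [r| |]//= _.
rewrite lte_fin => rt; near=> s; apply/eqP; rewrite eqn_leq; apply/andP; split.
  by rewrite -Nt; apply: cnt_homo; apply: ltW; near: s; exact: nbhs_left_lt.
by rewrite ltn_cnt wN lte_fin; near: s; exact: nbhs_left_gt.
Unshelve. all: by end_near. Qed.

Lemma cnt_at_right w t : \forall s \near t^'+, cnt w s = cntle w t.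
Proof.
pose N := cntle w t.
have tN : (t%:E < itime w N)%E by rewrite ltNge -ltn_cntle ltnn.
have [r tr rN] : exists2 r, t < r & (r%:E <= itime w N)%E.
  move: tN; case: (itime w N) => [r| |]//.
    by rewrite lte_fin => tr; exists r.
  by move=> _; exists (t + 1); rewrite ?ltrDl// leey.
near=> s; apply/eqP; rewrite eqn_leq; apply/andP; split.
  rewrite leqNgt ltn_cnt -leNgt (le_trans _ rN)// lee_fin; apply: ltW.
  by near: s; exact: nbhs_right_lt.
rewrite leqNgt; apply/negP; rewrite ltn_cntle leNgt => /negP; apply.
rewrite ltNge; apply/negP => wt.
have : (itime w (cnt w s) < s%:E)%E.
  by rewrite (le_lt_trans wt)// lte_fin; near: s; exact: nbhs_right_gt.
by rewrite -ltn_cnt ltnn.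
Unshelve. all: by end_near. Qed.

Lemma fsbig_itime (A : nmodType) (F : nat -> A) w t :
  \sum_(m \in [set m | itime w m = t%:E]) F m = \sum_(cnt w t <= m < cntle w t) F m.
Proof.
rewrite (_ : [set m | _] = [set` index_iota (cnt w t) (cntle w t)]).
  by rewrite -fsbig_seq// iota_uniq.
apply/seteqP; split => m /=; rewrite mem_index_iota ltn_cntle [(cnt w t <= m)%N]leqNgt ltn_cnt -leNgt.
  by move=> ->; rewrite lexx.
by move=> /andP[tm mt]; apply/le_anti; rewrite mt tm.
Qed.

End counting.

Section trajectories.
Context {R : realType} {n : nat} {U V : set 'rV[R]_n}.
Implicit Types (u : control U) (v : control V) (x : 'rV[R]_n) (t : R).

Definition effsize u v m : 'rV[R]_n := (effective u v m)%:R *: isize u m.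

(** The function [J] of the Picard construction. Impulses at [t] itself are left out, which makes it
    left continuous like the trajectories. *)
Definition cum u v t : 'rV[R]_n :=
  \sum_(0 <= m < cnt u t) effsize u v m + \sum_(0 <= k < cnt v t) isize v k.

Lemma jumpE u v t : jump u v t =
  \sum_(cnt u t <= m < cntle u t) effsize u v m +
  \sum_(cnt v t <= k < cntle v t) isize v k.
Proof. by rewrite /jump !fsbig_itime. Qed.

Lemma cum_at_left u v t : \forall s \near t^'-, cum u v s = cum u v t.
Proof.
near=> s; rewrite /cum; congr (_ + _).
  by have -> : cnt u s = cnt u t by near: s; exact: cnt_at_left.
by have -> : cnt v s = cnt v t by near: s; exact: cnt_at_left.
Unshelve. all: by end_near. Qed.

Lemma cum_at_right u v t : \forall s \near t^'+, cum u v s = cum u v t + jump u v t.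
Proof.
near=> s; rewrite jumpE /cum addrACA -!big_cat_nat ?cnt_le_cntle//=; congr (_ + _).
  by have -> : cnt u s = cntle u t by near: s; exact: cnt_at_right.
by have -> : cnt v s = cntle v t by near: s; exact: cnt_at_right.
Unshelve. all: by end_near. Qed.

Lemma jump_eq0 u v t :
  (forall m, itime u m <> t%:E) -> (forall k, itime v k <> t%:E) -> jump u v t = 0.
Proof.
move=> ut vt; rewrite /jump.
rewrite (_ : [set m | itime u m = t%:E] = set0); last by apply/seteqP; split.
rewrite (_ : [set m | itime v m = t%:E] = set0); last by apply/seteqP; split.
by rewrite !fsbig_set0 addr0.
Qed.

Lemma cum_near u v t :
  (forall m, itime u m <> t%:E) -> (forall k, itime v k <> t%:E) ->
  \forall s \near t, cum u v s = cum u v t.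
Proof.
move=> ut vt; have := cum_at_right u v t; rewrite jump_eq0// addr0 => cr.
have cl := cum_at_left u v t.
have := cl; rewrite near_withinE => {}cl; have := cr; rewrite near_withinE => {}cr.
near=> s; have [st|ts|->//] := ltgtP s t.
  by move: st; near: s.
by move: ts; near: s.
Unshelve. all: by end_near. Qed.

Lemma cum_left_continuous u v : left_continuous_gt0 (cum u v).
Proof.
by move=> t _; apply: cvg_near_cst; exact: cum_at_left.
Qed.

End trajectories.

Section ode.
Context {R : realType} {n : nat} {U V : set 'rV[R]_n}.
Variables (b : 'rV[R]_n -> 'rV[R]_n) (M L : R).
Hypotheses (L0 : 0 < L) (bM : forall y, `|b y| <= M)
  (bL : forall y z, `|b y - b z| <= L * `|y - z|).
Implicit Types (u : control U) (v : control V) (x : 'rV[R]_n) (t : R).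

(** The continuous part [z] is kept in the statement: its Lipschitz constant [M] does not depend on
    the controls, and this controls the drift between impulses. *)
Lemma trajectory_exists x u v : exists y, is_trajectory b x u v y /\
  exists z : R -> 'rV[R]_n, (forall t, y t = z t + cum u v t) /\
    (forall s t, `|z s - z t| <= M * `|s - t|).
Proof.
have [z [z0 zM dz]] := picard x L0 bM bL (@cum_left_continuous _ _ _ _ u v).
have zc : continuous z := lipschitz_continuous zM.
exists (fun t => z t + cum u v t); split; last by exists z.
split.
- by rewrite z0 /cum !cnt_le0// !big_geq// !addr0.
- move=> t t0; apply: cvgD; last exact: cum_left_continuous.
  by apply: cvg_at_left_filter; exact: zc.
- move=> t t0; rewrite -addrA; apply: cvgD.
    by apply: cvg_at_right_filter; exact: zc.
  by apply: cvg_near_cst; exact: cum_at_right.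
- move=> t t0 ut vt; have cn := cum_near ut vt.
  have cc : {for t, continuous (cum u v)}.
    exact: cvg_near_cst.
  have dz1 := dz t t0 cc.
  have : is_derive t 1 (z + cst (cum u v t)) (b (z t + cum u v t)).
    apply: (is_derive_eq (is_deriveD dz1 (is_derive_cst _ _ _))).
    by rewrite addr0.
  apply: near_eq_is_derive; near=> s; rewrite /=.
  have -> //: cum u v s = cum u v t by near: s.
Unshelve. all: by end_near. Qed.

Lemma trajectoryP x u v : is_trajectory b x u v (trajectory b x u v).
Proof.
have [y [yt _]] := trajectory_exists x u v.
by rewrite /trajectory; case: xgetP => [z -> //|/(_ y)].
Qed.

Definition times {S : set 'rV[R]_n} (w : control S) T : seq R :=
  [seq fine (itime w m) | m <- iota 0 (cnt w T)].

Lemma notin_times {S : set 'rV[R]_n} (w : control S) T t :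
  t < T -> t \notin times w T -> forall m, itime w m <> t%:E.
Proof.
move=> tT + m wm; move/negP; apply; apply/mapP; exists m; last by rewrite wm.
by rewrite mem_iota add0n/= ltn_cnt wm lte_fin.
Qed.

Lemma sqr_norm_natmul (x : 'rV[R]_n) : `|x| ^+ 2 <= n%:R * `|x| ^+ 2.
Proof.
rewrite (le_trans (sqr_norm_le_sum _))// mulr_natl -[X in _ *+ X]card_ord -sumr_const.
apply: ler_sum => i _.
by rewrite -real_normK ?num_real// ler_sqr ?nnegrE// ler_norm_entry.
Qed.

(** Equal jumps cancel in the difference of the trajectories, which is therefore continuous, and
    differentiable off the finitely many impulse times of the four controls; Gronwall's inequality
    applies. Taking [x = x'] gives uniqueness and dependence on the past only. *)
Lemma trajectory_dist (U' V' : set 'rV[R]_n) x u v y x' (u' : control U') (v' : control V') y' T :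
  is_trajectory b x u v y -> is_trajectory b x' u' v' y' -> 0 <= T ->
  (forall t, 0 <= t < T -> jump u v t = jump u' v' t) ->
  `|y T - y' T| ^+ 2 <= n%:R * expR (2 * n%:R * L * T) * `|x - x'| ^+ 2.
Proof.
move=> [y0 yl yr yd] [y0' yl' yr' yd'].
rewrite le_eqVlt => /predU1P[<- _|T0 jE].
  by rewrite y0 y0' mulr0 expR0 mulr1 sqr_norm_natmul.
pose s := times u T ++ times v T ++ times u' T ++ times v' T.
have rc t : 0 <= t < T -> y s - y' s @[s --> t^'+] --> y t - y' t.
  move=> /andP[t0 tT]; rewrite (_ : y t - y' t = y t + jump u v t - (y' t + jump u' v' t)).
    by apply: cvgB; [exact: yr|exact: yr'].
  by rewrite jE ?t0// opprD addrACA subrr addr0.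
rewrite -y0 -y0'.
apply: (@gronwall R n (fun t => y t - y' t) (fun t => b (y t) - b (y' t)) L T s).
- exact: ltW.
- exact: ltW.
- apply/continuous_within_itvP => //; split.
  + move=> t; rewrite in_itv/= => /andP[t0 tT]; apply/left_right_continuousP; split.
      by apply: cvgB; [exact: yl|exact: yl'].
    by apply: rc; rewrite tT ltW.
  + by apply: rc; rewrite lexx.
  + by apply: cvgB; [exact: yl|exact: yl'].
- move=> t /andP[t0 tT]; rewrite !mem_cat !negb_or => /and4P[ut vt ut' vt'].
  split; last exact: bL.
  by apply: is_deriveB; [apply: yd|apply: yd'] => //; apply: notin_times; eauto.
Qed.

Lemma trajectory_unique (U' V' : set 'rV[R]_n) x u v y (u' : control U') (v' : control V') y' T :
  is_trajectory b x u v y -> is_trajectory b x u' v' y' -> 0 <= T ->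
  (forall t, 0 <= t < T -> jump u v t = jump u' v' t) -> y T = y' T.
Proof.
move=> yt yt' T0 jE; apply/eqP; rewrite -subr_eq0 -normr_eq0 -sqrf_eq0 eq_le sqr_ge0 andbT.
by rewrite (le_trans (trajectory_dist yt yt' T0 jE))// subrr normr0 expr0n/= mulr0.
Qed.

Lemma trajectory_displacement x u v t : 0 <= t ->
  `|trajectory b x u v t - (x + cum u v t)| <= M * t.
Proof.
move=> t0; have [y [yt [z [yz zM]]]] := trajectory_exists x u v.
rewrite (trajectory_unique (trajectoryP x u v) yt t0)// yz.
have -> : x = z 0.
  by have [<- _ _ _] := yt; rewrite yz /cum !cnt_le0// !big_geq// !addr0.
by rewrite opprD addrACA subrr addr0 (le_trans (zM _ _))// subr0 ger0_norm.
Qed.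

End ode.

(** * The gain after a fixed time *)

Section running_cost.
Context {R : realType} {n : nat} {U V : set 'rV[R]_n}.
Variables (b : 'rV[R]_n -> 'rV[R]_n) (f : 'rV[R]_n -> R) (lam M L F K : R).
Hypotheses (lam0 : 0 < lam) (L0 : 0 < L) (bM : forall y, `|b y| <= M)
  (bL : forall y z, `|b y - b z| <= L * `|y - z|)
  (fF : forall y, `|f y| <= F)
  (fK : forall y z, `|f y - f z| <= K * `|y - z|).
Notation mu := (@lebesgue_measure R).
Notation Y := (trajectory b).
Implicit Types (u : control U) (v : control V) (x : 'rV[R]_n) (t : R).

Definition integrand x u v t := f (Y x u v t) * expR (- lam * t).

Let F_ge0 : 0 <= F. Proof. exact: le_trans (fF 0). Qed.
Lemma integrand_left_continuous x u v : left_continuous_gt0 (integrand x u v).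
Proof.
move=> t t0; apply: cvgM; last first.
  by apply: cvg_at_left_filter; exact: continuous_expRM.
have [_ yl _ _] := trajectoryP L0 bM bL x u v.
apply: (@cvg_comp _ _ _ (Y x u v) f _ (nbhs (Y x u v t))); first exact: yl.
exact: (@lipschitz_continuous _ 'rV[R]_n R^o f K fK).
Qed.

Lemma norm_integrand_le x u v t : `|integrand x u v t| <= F * expR (- lam * t).
Proof. by rewrite normrM [`|expR _|]ger0_norm ?expR_ge0// ler_wpM2r ?expR_ge0. Qed.

Lemma integrable_integrand x u v : mu.-integrable `[0, +oo[ (EFin \o integrand x u v).
Proof.
have iF : mu.-integrable `[0, +oo[ (EFin \o (fun t => F * expR (- lam * t))).
  by apply: integrableZ_itv; exact: integrable_expRN.
apply: le_integrable_itv iF.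
  by apply: left_continuous_measurable; exact: integrand_left_continuous.
by move=> t _; exact: norm_integrand_le.
Qed.

Lemma integrable_integrandS x u v (i : interval R) :
  [set` i] `<=` `[0, +oo[ -> mu.-integrable [set` i] (EFin \o integrand x u v).
Proof. by move=> iS; apply: integrableS (integrable_integrand x u v). Qed.

Definition running x u v := \int[mu]_(t in `[0, +oo[) integrand x u v t.

Lemma runningE x u v :
  (\int[mu]_(t in `[0%R, +oo[) (f (Y x u v t) * expR (- lam * t))%:E)%E =
  (running x u v)%:E.
Proof.
by rewrite fineK//; apply: integrable_fin_num => //; exact: integrable_integrand.
Qed.

Lemma norm_running_le x u v : `|running x u v| <= F / lam.
Proof.
apply: Rintegral_expRN_le => //; first exact: integrable_integrand.
by move=> t _; exact: norm_integrand_le.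
Qed.

Definition flow_gain x u v s := \int[mu]_(t in `[0, s[) integrand x u v t.

(** Agreement is asked for [0 < r] only. At [r = 0] it may fail, for instance when [x'] already
    contains an impulse of player-eta at time [s]; a single time does not affect the integral. *)
Lemma running_shift x u v s x' (u' : control U) (v' : control V) :
  0 <= s -> (forall r, 0 < r -> Y x u v (s + r) = Y x' u' v' r) ->
  running x u v = flow_gain x u v s + expR (- lam * s) * running x' u' v'.
Proof.
move=> s0 YE; rewrite /running /flow_gain.
have sub0 : [set` `[0, s[] `<=` `[0, +oo[%classic.
  by move=> t /=; rewrite !in_itv/= andbT => /andP[].
have sub1 : [set` `[s, +oo[] `<=` `[0, +oo[%classic.
  by move=> t /=; rewrite !in_itv/= !andbT; exact: le_trans.
have U01 : `[0, +oo[%classic = `[0, s[ `|` `[s, +oo[ :> set R.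
  by apply: itv_bndbnd_setU; rewrite bnd_simp.
rewrite {1}U01 Rintegral_setU//; last 2 first.
- by rewrite -U01; exact: integrable_integrand.
- apply/disj_setPS => t /=; rewrite !in_itv/= andbT => -[/andP[_ ts]].
  by rewrite leNgt ts.
congr (_ + _).
have ae : {in `]0, +oo[%classic, integrand x u v \o +%R s =1
    (fun r => expR (- lam * s) * integrand x' u' v' r)}.
  move=> r; rewrite inE/= in_itv/= andbT => r0.
  by rewrite /integrand YE// mulrDr expRD; ring.
have iR : mu.-integrable `]0, +oo[ (EFin \o (fun r => expR (- lam * s) * integrand x' u' v' r)).
  apply: integrableZ_itv.
  by apply: integrable_integrandS; apply: subset_itvr; rewrite bnd_simp.
have iL : mu.-integrable `]0, +oo[ (EFin \o (integrand x u v \o +%R s)).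
  by apply: eq_integrable iR => // r r0; congr EFin; exact/esym/ae.
have iL0 : mu.-integrable `[0, +oo[ (EFin \o (fun r => integrand x u v (s + r))).
  have mL : @measurable_fun _ _ R R `[0, +oo[%classic (fun r => integrand x u v (s + r)).
    apply/measurable_fun_itv_obnd_cbndP.
    by move/integrableP : iL => [/measurable_EFinP].
  apply: (@le_integrable_itv _ _ _ (fun t => F * expR (- lam * t))) => //.
  - move=> r /=; rewrite in_itv/= andbT => r0.
    rewrite (le_trans (norm_integrand_le _ _ _ _))//.
    rewrite ler_wpM2l// ler_expR !mulNr lerN2 ler_wpM2l//; first exact: ltW.
    by rewrite lerDr.
  - by apply: integrableZ_itv; exact: integrable_expRN.
have := integral_shift_itvcy (integrable_integrandS x u v sub1) iL0.
rewrite /Rintegral => /= ->.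
rewrite -[in LHS]integral_itv_obnd_cbnd; last first.
  by move/integrableP : iL => [].
under eq_integral => r r0 do rewrite [integrand _ _ _ _]ae//.
rewrite integral_itv_obnd_cbnd; last by move/integrableP : iR => [].
by rewrite -[LHS]/(\int[mu]_(r in _) _) RintegralZl//; exact: integrable_integrand.
Qed.

Lemma norm_trajectory_dist x x' u v t : 0 <= t ->
  `|Y x u v t - Y x' u v t| <= n%:R * expR (2 * n%:R * L * t) * `|x - x'|.
Proof.
move=> t0.
have := trajectory_dist L0 bL (trajectoryP L0 bM bL x u v)
  (trajectoryP L0 bM bL x' u v) t0 (fun _ _ => erefl).
set E := expR _ => le2.
have E1 : 1 <= E.
  by rewrite -expR0 ler_expR !mulr_ge0// ltW.
have nE0 : 0 <= n%:R * E by rewrite mulr_ge0// (le_trans _ E1).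
have rhs0 : 0 <= n%:R * E * `|x - x'| by rewrite mulr_ge0.
rewrite -(@ler_pXn2r _ 2) ?nnegrE//; apply: (le_trans le2).
rewrite exprMn ler_wpM2r ?sqr_ge0//; have [n0|n0] := leqP n 0.
  have -> : (n%:R : R) = 0 by move: n0; rewrite leqn0 => /eqP ->.
  by rewrite !mul0r expr0n.
rewrite expr2 -[leLHS]mul1r ler_wpM2r//.
by rewrite -[leLHS]mul1r ler_pM// ler1n.
Qed.

(** Trajectories may separate faster than the discount decays, so time is split at a horizon [T]:
    before it, Gronwall's inequality and the Lipschitz bound on [f]; after it, boundedness of [f]
    and the discount. The estimate is uniform in both controls, hence passes to the values. *)
Lemma running_uniform_continuity (e : R) : 0 < e -> exists2 d, 0 < d &
  forall x x' u v, `|x - x'| <= d -> `|running x u v - running x' u v| <= e.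
Proof.
move=> e0; have K0 : 0 <= `|K| by [].
(* Half of the discount rate is kept for integrability: the integrand is bounded by
   [e * (lam / 2) * expR (- (lam / 2) * t)], of integral [e]. The other half is at most [s^-1]
   beyond [T], where [2 * F * s^-1 <= e * (lam / 2)]. *)
pose s := 8 * F / (lam * e) + 1.
have s0 : 0 < s by rewrite ltr_wpDl// divr_ge0 ?mulr_ge0// ltW.
pose T := 2 * s / lam.
have T0 : 0 < T by rewrite divr_gt0 ?mulr_gt0.
pose A := `|K| * (n%:R * expR (2 * n%:R * L * T)).
have A0 : 0 <= A by rewrite !mulr_ge0// expR_ge0.
pose d := e * lam / (4 * (A + 1)).
have d0 : 0 < d by rewrite divr_gt0 ?mulr_gt0// ltr_wpDl.
exists d => // x x' u v xd.
rewrite /running -RintegralB//; try exact: integrable_integrand.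
have lam2 : 0 < lam / 2 by rewrite divr_gt0.
have -> : e = (e * (lam / 2)) / (lam / 2) by rewrite mulfK// gt_eqF.
apply: Rintegral_expRN_le => //.
  apply: eq_integrable (integrableB _ (integrable_integrand x u v) (integrable_integrand x' u v)) => //.
move=> t t0; rewrite /integrand -mulrBl normrM [`|expR _|]ger0_norm ?expR_ge0//.
have e2 : expR (- lam * t) = expR (- (lam / 2) * t) * expR (- (lam / 2) * t).
  by rewrite -expRD; congr expR; field.
have [tT|Tt] := leP t T.
  rewrite e2 [leLHS]mulrA ler_wpM2r ?expR_ge0//.
  have e1 : expR (- (lam / 2) * t) <= 1.
    by rewrite -[leRHS]expR0 ler_expR mulNr oppr_le0 mulr_ge0// ltW.
  rewrite (@le_trans _ _ `|f (Y x u v t) - f (Y x' u v t)|)//.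
    by rewrite -[leRHS]mulr1 ler_wpM2l.
  rewrite (le_trans (fK _ _))// (@le_trans _ _ (A * d))//.
    rewrite (@le_trans _ _ (`|K| * `|Y x u v t - Y x' u v t|))//.
      by rewrite ler_wpM2r// ler_norm.
    rewrite -mulrA ler_wpM2l// (le_trans (norm_trajectory_dist _ _ _ _ t0))//.
    rewrite ler_pM// ?mulr_ge0 ?expR_ge0// ler_wpM2l// ler_expR ler_wpM2l//.
    by rewrite !mulr_ge0// ltW.
  rewrite (@le_trans _ _ ((A + 1) * d))//; first by rewrite ler_wpM2r// ?lerDl// ltW.
  have -> : (A + 1) * d = e * lam / 4.
    by rewrite /d; field; rewrite gt_eqF// ltr_wpDl.
  have el : 0 < e * lam by rewrite mulr_gt0.
  by lra.
rewrite e2 [leLHS]mulrA ler_wpM2r ?expR_ge0//.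
have f2 : `|f (Y x u v t) - f (Y x' u v t)| <= 2 * F.
  by rewrite (le_trans (ler_normB _ _))// mulr_natl mulr2n lerD.
have es : expR (- (lam / 2) * t) <= s^-1.
  rewrite (@le_trans _ _ (expR (- s)))//.
    rewrite ler_expR mulNr lerN2 (@le_trans _ _ (lam / 2 * T))//.
      by rewrite /T le_eqVlt; apply/orP; left; apply/eqP; field; rewrite gt_eqF.
    by rewrite ler_wpM2l// ltW.
  rewrite expRN lef_pV2 ?posrE ?expR_gt0// (le_trans _ (expR_ge1Dx _))//.
  by rewrite lerDr.
rewrite (@le_trans _ _ (2 * F * s^-1))//.
  by rewrite ler_pM ?expR_ge0.
rewrite ler_pdivrMr// /s mulrDr mulr1.
have -> : e * (lam / 2) * (8 * F / (lam * e)) = 4 * F.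
  by field; rewrite !gt_eqF.
have : 0 < e * (lam / 2) by rewrite mulr_gt0.
by have := F_ge0; lra.
Qed.

End running_cost.

Section costs.
Context {R : realType}.
Implicit Types (lam s : R) (t : \bar R).

Lemma nneseries_cut (a a' : nat -> \bar R) (N : nat) (e : R) : 0 <= e ->
  (forall m, (0 <= a m)%E) -> (forall m, (0 <= a' m)%E) ->
  (forall m, a (N + m)%N = (e%:E * a' m)%E) ->
  (\sum_(0 <= m <oo) a m = \sum_(0 <= m < N) a m + e%:E * \sum_(0 <= m <oo) a' m)%E.
Proof.
move=> e0 a0 a0' aa'; rewrite (nneseries_split 0 N) ?add0n//; congr (_ + _)%E.
rewrite -nneseries_addn// -nneseriesZl//; apply: eq_eseriesr => m _.
by rewrite addnC aa'.
Qed.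

Lemma expeR_shift lam s t : 0 < lam -> (0 <= t)%E ->
  expeR (- (lam%:E * (s%:E + t)))%E = ((expR (- lam * s))%:E * expeR (- (lam%:E * t)))%E.
Proof.
move=> lam0; case: t => [r| |]//= _.
  by rewrite -EFinM -expRD mulrDr mulNr opprD.
by rewrite addey// !gt0_muley ?lte_fin//= mule0.
Qed.

(** Infinite costs are allowed. If [C] and [X] are both [+oo], both sides are [-oo], so cutting the
    gain is compatible with its convention. *)
Lemma affine_combination (i p q e j : R) (C X : \bar R) : 0 < e -> (0 <= C)%E -> (0 <= X)%E ->
  ((i + e * j)%:E - (p%:E + e%:E * C) + (q%:E + e%:E * X) =
  (i - p + q)%:E + e%:E * (j%:E - C + X))%E.
Proof.
move=> e0; case: C => [C| |]//= _; case: X => [X| |]//= _;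
  rewrite ?gt0_muley ?lte_fin//=.
- by congr EFin; ring.
- by rewrite gt0_muleNy ?lte_fin.
- by rewrite gt0_muleNy ?lte_fin.
Qed.

End costs.

Section impulse_costs.
Context {R : realType} {n : nat} {S : set 'rV[R]_n}.
Variables (c : 'rV[R]_n -> R) (lam : R).
Hypotheses (lam0 : 0 < lam) (c0 : forall z, S z -> 0 <= c z).
Implicit Types (w : control S) (p : nat -> bool).

(** The filter [p] retains the effective impulses of player-xi, or all those of player-eta. The real
    counterpart [paid] is meaningful when the first [N] impulse times are finite. *)
Definition cost_term w p m : \bar R :=
  ((c (isize w m))%:E * expeR (- (lam%:E * itime w m)) * ((p m)%:R)%:E)%E.

Definition paid w p N : R :=
  \sum_(0 <= m < N) c (isize w m) * expR (- lam * fine (itime w m)) * (p m)%:R.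

Lemma cost_term_ge0 w p m : (0 <= cost_term w p m)%E.
Proof.
rewrite /cost_term; have [->|wm] := eqVneq (itime w m) +oo%E.
  by rewrite gt0_muley ?lte_fin//= mule0 mul0e.
rewrite !mule_ge0 ?expeR_ge0 ?lee_fin ?ler0n//.
by apply: c0; apply: isize_in; exact/eqP.
Qed.

Lemma cost_term_cut w w' p p' N s m : itime w (N + m)%N = (s%:E + itime w' m)%E ->
  isize w (N + m)%N = isize w' m -> p (N + m)%N = p' m ->
  cost_term w p (N + m)%N = ((expR (- lam * s))%:E * cost_term w' p' m)%E.
Proof.
move=> tE sE pE; rewrite /cost_term tE sE pE expeR_shift// ?itime_ge0//.
by rewrite muleCA !muleA.
Qed.

Lemma sum_cost_term w p N (s : R) : (forall m, (m < N)%N -> (itime w m <= s%:E)%E) ->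
  (\sum_(0 <= m < N) cost_term w p m = (paid w p N)%:E)%E.
Proof.
move=> ws; rewrite /paid -sumEFin !big_mkord; apply: eq_bigr => m _.
have := ws m (ltn_ord m); have := itime_ge0 w m; rewrite /cost_term.
by case: (itime w m) => // r _ _; rewrite -!EFinM/= mulNr.
Qed.

End impulse_costs.

Lemma eq_nat_ltn (a a' : nat) : (forall m, (m < a)%N = (m < a')%N) -> a = a'.
Proof.
move=> aa'; apply/eqP; rewrite eqn_leq; apply/andP; split.
  by rewrite leqNgt aa' ltnn.
by rewrite leqNgt -aa' ltnn.
Qed.

Section cut_times.
Context {R : realType} {n : nat} {S : set 'rV[R]_n}.
Variables (w w' : control S) (N : nat) (s r : R).
Hypotheses (tw : forall m, itime w (N + m)%N = (s%:E + itime w' m)%E)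
  (ws : forall m, (m < N)%N -> (itime w m <= s%:E)%E).

(** Strict positivity of [r] matters: impulses at time [s] itself may be among the first [N], as
    happens when a pulse at time 0 is split off. *)
Lemma cnt_cut : 0 < r -> cnt w (s + r) = (N + cnt w' r)%N.
Proof.
move=> r0; apply: eq_nat_ltn => m; rewrite ltn_cnt; have [mN|Nm] := ltnP m N.
  rewrite (leq_trans mN) ?leq_addr//.
  by rewrite (le_lt_trans (ws mN))// lte_fin ltrDl.
by rewrite -(subnKC Nm) ltn_add2l ltn_cnt tw EFinD lteD2lE.
Qed.

Lemma cntle_cut : 0 <= r -> cntle w (s + r) = (N + cntle w' r)%N.
Proof.
move=> r0; apply: eq_nat_ltn => m; rewrite ltn_cntle; have [mN|Nm] := ltnP m N.
  rewrite (leq_trans mN) ?leq_addr//.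
  by rewrite (le_trans (ws mN))// lee_fin lerDl.
by rewrite -(subnKC Nm) ltn_add2l ltn_cntle tw EFinD leeD2lE.
Qed.

End cut_times.

(** * Splitting the gain at a given time *)

Section gain_cut.
Context {R : realType} {n : nat} {U V : set 'rV[R]_n}.
Variables (b : 'rV[R]_n -> 'rV[R]_n) (f c chi : 'rV[R]_n -> R) (lam M L F K : R).
Hypotheses (lam0 : 0 < lam) (L0 : 0 < L) (bM : forall y, `|b y| <= M)
  (bL : forall y z, `|b y - b z| <= L * `|y - z|)
  (fF : forall y, `|f y| <= F)
  (fK : forall y z, `|f y - f z| <= K * `|y - z|)
  (c0 : forall z, U z -> 0 <= c z) (chi0 : forall z, V z -> 0 <= chi z).
Notation Y := (trajectory b).
Notation J := (gain b f c chi lam).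
Implicit Types (u : control U) (v : control V) (x : 'rV[R]_n) (t : R).

Lemma gainE x u v : J x u v = ((running b f lam x u v)%:E
  - \sum_(0 <= m <oo) cost_term c lam u (effective u v) m
  + \sum_(0 <= k <oo) cost_term chi lam v xpredT k)%E.
Proof.
rewrite /gain (runningE lam0 L0 bM bL fF fK); congr (_ + _)%E.
by apply: eq_eseriesr => k _; rewrite /cost_term mule1.
Qed.

Section cut.
Variables (u u' : control U) (v v' : control V) (x x' : 'rV[R]_n) (s : R).
Variables (Nu Nv : nat).
Hypotheses (s0 : 0 <= s)
  (tu : forall m, itime u (Nu + m)%N = (s%:E + itime u' m)%E)
  (su : forall m, isize u (Nu + m)%N = isize u' m)
  (tv : forall m, itime v (Nv + m)%N = (s%:E + itime v' m)%E)
  (sv : forall m, isize v (Nv + m)%N = isize v' m)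
  (us : forall m, (m < Nu)%N -> (itime u m <= s%:E)%E)
  (vs : forall m, (m < Nv)%N -> (itime v m <= s%:E)%E)
  (uv : forall m, effective u v (Nu + m)%N = effective u' v' m)
  (xs : Y x u v s + jump u v s = x' + jump u' v' 0).

Lemma jump_cut r : 0 < r -> jump u v (s + r) = jump u' v' r.
Proof.
move=> r0; rewrite !jumpE (cnt_cut tu us r0) (cntle_cut tu us (ltW r0)).
rewrite (cnt_cut tv vs r0) (cntle_cut tv vs (ltW r0)) ![(_ + cnt _ _)%N]addnC !big_addn !addKn.
congr (_ + _); apply: eq_bigr => m _; rewrite addnC.
  by rewrite /effsize uv su.
by rewrite sv.
Qed.

(** The shifted trajectory, with its value at 0 replaced by [x'], is a trajectory of the remaining
    game: hypothesis [xs] is exactly what its right limit at 0 requires. Uniqueness concludes. *)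
Lemma trajectory_cut r : 0 < r -> Y x u v (s + r) = Y x' u' v' r.
Proof.
have [y0 yl yr yd] := trajectoryP L0 bM bL x u v.
pose y t := if t <= 0 then x' else Y x u v (s + t).
suff yt : is_trajectory b x' u' v' y.
  move=> r0; have := trajectory_unique L0 bL yt (trajectoryP L0 bM bL x' u' v') (ltW r0) (fun _ _ => erefl).
  by rewrite /y leNgt r0.
have shl (t : R) : s + q @[q --> t^'-] --> (s + t)^'-.
  move=> A [e /= e0 eA]; exists e => //= q tq qt.
  by apply: eA => /=; rewrite ?ltrD2l// opprD addrACA subrr add0r.
have shr (t : R) : s + q @[q --> t^'+] --> (s + t)^'+.
  move=> A [e /= e0 eA]; exists e => //= q tq qt.
  by apply: eA => /=; rewrite ?ltrD2l// opprD addrACA subrr add0r.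
have ypos t : 0 < t -> y t = Y x u v (s + t) by move=> t0; rewrite /y leNgt t0.
split.
- by rewrite /y lexx.
- move=> t t0; rewrite ypos//.
  have st : 0 < s + t by rewrite ltr_wpDl.
  apply: cvg_trans (cvg_comp _ _ (shl t) (yl _ st)); apply: near_eq_cvg.
  near=> q; rewrite /= ypos//; near: q; exact: nbhs_left_gt.
- move=> t t0; have -> : y t + jump u' v' t = Y x u v (s + t) + jump u v (s + t).
    move: t0; rewrite le_eqVlt => /predU1P[<-|t0].
      by rewrite addr0 xs /y lexx.
    by rewrite ypos// jump_cut.
  have st : 0 <= s + t by rewrite addr_ge0.
  apply: cvg_trans (cvg_comp _ _ (shr t) (yr _ st)); apply: near_eq_cvg.
  near=> q; rewrite /= ypos// (le_lt_trans t0)//; near: q; exact: nbhs_right_gt.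
- move=> t t0 ut vt; rewrite ypos//.
  have notin (S : set 'rV[R]_n) (w w' : control S) N :
      (forall m, itime w (N + m)%N = (s%:E + itime w' m)%E) ->
      (forall m, (m < N)%N -> (itime w m <= s%:E)%E) ->
      (forall m, itime w' m <> t%:E) -> forall m, itime w m <> (s + t)%:E.
    move=> tw ws w't m; have [mN wm|Nm] := ltnP m N.
      by have := ws m mN; rewrite wm lee_fin gerDl leNgt t0.
    rewrite -(subnKC Nm) tw EFinD => /eqP; have := w't (m - N)%N.
    case: (itime w' _) => [q| |]//= + /eqP [] /addrI.
    by move=> qt qE; apply: qt; rewrite qE.
  have ds : is_derive t 1 (+%R s) 1.
    apply: (is_derive_eq (is_deriveD (is_derive_cst s t 1) (is_derive_id t 1))).
    by rewrite add0r.
  have st : 0 < s + t by rewrite ltr_wpDl.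
  have dY := yd (s + t) st (notin _ _ _ _ tu us ut) (notin _ _ _ _ tv vs vt).
  have : is_derive t 1 (Y x u v \o +%R s) (b (Y x u v (s + t))).
    apply: is_derive_row => i.
    apply: (is_derive_eq (is_derive1_comp (is_derive_entry i dY) ds)).
    by rewrite mulr1.
  apply: near_eq_is_derive; near=> q; rewrite /= ypos//; near: q.
  exact: lt_nbhsr.
Unshelve. all: by end_near. Qed.

(** Used in two ways: at a time [s], with the impulses strictly before [s] split off, for dynamic
    programming; and at time 0, with a pulse of player-eta and the impulses it cancels split off. *)
Lemma gain_cut : J x u v = ((flow_gain b f lam x u v s
    - paid c lam u (effective u v) Nu + paid chi lam v xpredT Nv)%:E
  + (expR (- lam * s))%:E * J x' u' v')%E.
Proof.
rewrite !gainE (running_shift lam0 L0 bM bL fF fK s0 trajectory_cut).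
rewrite (@nneseries_cut _ _ (cost_term c lam u' (effective u' v')) Nu (expR (- lam * s))); last 4 first.
- exact: expR_ge0.
- by move=> m; exact: cost_term_ge0.
- by move=> m; exact: cost_term_ge0.
- by move=> m; exact: cost_term_cut.
rewrite (@nneseries_cut _ (cost_term chi lam v xpredT) (cost_term chi lam v' xpredT) Nv (expR (- lam * s))); last 4 first.
- exact: expR_ge0.
- by move=> m; exact: cost_term_ge0.
- by move=> m; exact: cost_term_ge0.
- by move=> m; exact: cost_term_cut.
rewrite (sum_cost_term c lam _ us) (sum_cost_term chi lam _ vs).
rewrite affine_combination ?expR_gt0//; apply: nneseries_ge0 => m _ _; exact: cost_term_ge0.
Qed.

End cut.

End gain_cut.

(** * Operations on controls *)

Section operations.
Context {R : realType} {n : nat} {S : set 'rV[R]_n}.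
Implicit Types (w : control S) (s t : R).

Definition no_impulse : control S.
Proof.
apply: (@Control R n S (fun=> +oo%E) (fun=> 0)) => //.
by apply: cvg_cst.
Defined.

(* Meant for [s <= itime w N]: earlier times are truncated to 0. *)
Definition cut (N : nat) s w : control S.
Proof.
apply: (@Control R n S (fun m => maxe 0%E (itime w (N + m)%N - s%:E)%E) (fun m => isize w (N + m)%N)).
- by move=> m; rewrite le_max lexx.
- move=> m k mk; rewrite le_max2// leeB// itime_nondecreasing// leq_add2l//.
- apply/cvgeyPge => A; have [N' _ Nw] := (cvgeyPge _).1 (itime_cvgy w) (A + s).
  exists N' => // m /= Nm; rewrite le_max; apply/orP; right.
  rewrite EFinN leeBrDr// -EFinD; apply: Nw => /=.
  by rewrite (leq_trans Nm)// leq_addl.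
- move=> m wm; apply: isize_in => wE; apply: wm; rewrite wE.
  by rewrite addye// maxey.
- move=> m wm; apply: isize_neq0 => wE; apply: wm; rewrite wE.
  by rewrite addye// maxey.
Defined.

(** An impulse of [w0] at time [s] is discarded: from [s] on, included, [w] decides. *)
Definition glue s (s0 : 0 <= s) w0 w : control S.
Proof.
pose N := cnt w0 s.
apply: (@Control R n S (fun m => if (m < N)%N then itime w0 m else (s%:E + itime w (m - N)%N)%E)
  (fun m => if (m < N)%N then isize w0 m else isize w (m - N)%N)).
- by move=> m; case: ifP => _; rewrite ?adde_ge0 ?itime_ge0.
- move=> m k mk; case: ltnP => [mN|Nm]; case: ltnP => [kN|Nk].
  + exact: itime_nondecreasing.
  + move: mN; rewrite ltn_cnt => /ltW/le_trans; apply.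
    by rewrite leeDl// itime_ge0.
  + by have := leq_ltn_trans (leq_trans Nm mk) kN; rewrite ltnn.
  + by rewrite leeD2l// itime_nondecreasing// leq_sub2r.
- apply/cvgeyPge => A; have [N' _ Nw] := (cvgeyPge _).1 (itime_cvgy w) (A - s).
  exists (N + N')%N => // m /= Nm; rewrite ltnNge (leq_trans _ Nm) ?leq_addr//=.
  by rewrite -leeBlDl// -EFinB Nw//= leq_subRL// (leq_trans _ Nm)// leq_addr.
- move=> m; case: ifP => [mN wm|_ wm]; first exact: isize_in.
  by apply: isize_in => wE; apply: wm; rewrite wE addey.
- move=> m; case: ifP => [mN wm|_ wm]; first exact: isize_neq0.
  by apply: isize_neq0 => wE; apply: wm; rewrite wE addey.
Defined.

Definition pulse (z : 'rV[R]_n) (Sz : S z) (z0 : z <> 0) w : control S.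
Proof.
apply: (@Control R n S (fun m => if m is k.+1 then itime w k else 0%E)
  (fun m => if m is k.+1 then isize w k else z)).
- by case=> [|k] //; exact: itime_ge0.
- by move=> [|m] [|k]//= mk; [exact: itime_ge0|exact: itime_nondecreasing].
- apply/cvgeyPge => A; have [N' _ Nw] := (cvgeyPge _).1 (itime_cvgy w) A.
  by exists N'.+1 => // -[|m]//= Nm; apply: Nw.
- by move=> [|m] wm //; exact: isize_in.
- by move=> [|m] wm //; exact: isize_neq0.
Defined.

Definition restart s w := cut (cnt w s) s w.

(** Half-open counterpart of [agree_upto]. The left-continuous state at [s] and the costs paid
    before [s] depend on these impulses only; those at [s] are handed over to [restart]. *)
Definition agree_before s w1 w2 :=
  forall m, (itime w1 m < s%:E)%E \/ (itime w2 m < s%:E)%E ->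
    itime w1 m = itime w2 m /\ isize w1 m = isize w2 m.

Lemma itime_cut N s w m : (s%:E <= itime w N)%E ->
  itime w (N + m)%N = (s%:E + itime (cut N s w) m)%E.
Proof.
move=> sN; rewrite /= EFinN max_r; first by rewrite addeC subeK.
by rewrite leeBrDr// add0e (le_trans sN)// itime_nondecreasing// leq_addr.
Qed.

Lemma itime_restart s w m : itime w (cnt w s + m)%N = (s%:E + itime (restart s w) m)%E.
Proof. by apply: itime_cut; rewrite leNgt -ltn_cnt ltnn. Qed.

Lemma agree_upto_sym t w1 w2 : agree_upto t w1 w2 -> agree_upto t w2 w1.
Proof. by move=> a m /or_comm/a[-> ->]. Qed.

Lemma agree_upto_trans t w1 w2 w3 :
  agree_upto t w1 w2 -> agree_upto t w2 w3 -> agree_upto t w1 w3.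
Proof.
move=> a12 a23 m [h|h].
  have [e12 ->] := a12 m (or_introl h); rewrite e12.
  by apply: a23; left; rewrite -e12.
have [e23 <-] := a23 m (or_intror h); rewrite -e23.
by apply: a12; right; rewrite e23.
Qed.

Lemma agree_uptoW s t w1 w2 : s <= t -> agree_upto t w1 w2 -> agree_upto s w1 w2.
Proof. by move=> st a m [] h; apply: a; [left|right]; apply: le_trans h _. Qed.

Lemma agree_before_upto s t w1 w2 : s <= t -> agree_upto t w1 w2 -> agree_before s w1 w2.
Proof.
by move=> st a m [] h; apply: a; [left|right]; rewrite (le_trans (ltW h)).
Qed.

Lemma agree_upto_before s w1 w2 :
  (forall t, 0 <= t < s -> agree_upto t w1 w2) -> agree_before s w1 w2.
Proof.
move=> a m.
have h w : (itime w m < s%:E)%E -> exists2 t, 0 <= t < s & itime w m = t%:E.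
  have := itime_ge0 w m; case: (itime w m) => [r| |]//.
  by rewrite lee_fin lte_fin => r0 rs; exists r => //; rewrite r0.
by case=> /h [t ts wt]; apply: (a t ts); [left|right]; rewrite wt.
Qed.

Lemma agree_before_ltW s t w1 w2 : t < s -> agree_before s w1 w2 -> agree_upto t w1 w2.
Proof.
by move=> ts a m [] h; apply: a; [left|right]; rewrite (le_lt_trans h).
Qed.

Lemma agree_before_cnt s w1 w2 : agree_before s w1 w2 -> cnt w1 s = cnt w2 s.
Proof.
move=> a; apply: eq_nat_ltn => m; rewrite !ltn_cnt; apply/idP/idP => h.
  by have [<- _] := a m (or_introl h).
by have [-> _] := a m (or_intror h).
Qed.

Lemma agree_upto_cntle t w1 w2 : agree_upto t w1 w2 -> cntle w1 t = cntle w2 t.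
Proof.
move=> a; apply: eq_nat_ltn => m; rewrite !ltn_cntle; apply/idP/idP => h.
  by have [<- _] := a m (or_introl h).
by have [-> _] := a m (or_intror h).
Qed.

Lemma agree_upto_glue s t (s0 : 0 <= s) w0 w1 w2 : agree_upto t w1 w2 ->
  agree_upto (s + t) (glue s0 w0 w1) (glue s0 w0 w2).
Proof.
move=> a m /=; case: ifP => // _; rewrite !EFinD !leeD2lE// => h.
by have [-> ->] := a _ h.
Qed.

Lemma agree_before_glue s (s0 : 0 <= s) w0 w : agree_before s (glue s0 w0 w) w0.
Proof.
move=> m /=; case: ifPn => //; rewrite -leqNgt => Nm [|].
  by rewrite gteDl ?ltNge ?itime_ge0.
by rewrite -ltn_cnt ltnNge Nm.
Qed.

Lemma cnt_glue s (s0 : 0 <= s) w0 w : cnt (glue s0 w0 w) s = cnt w0 s.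
Proof. exact/agree_before_cnt/agree_before_glue. Qed.

Lemma restart_glue s (s0 : 0 <= s) w0 w : restart s (glue s0 w0 w) = w.
Proof.
apply: control_ext; apply/funext => m; rewrite /= cnt_glue ltnNge leq_addr/= addKn//.
rewrite EFinN [(s%:E + _)%E]addeC addeK// max_r// itime_ge0//.
Qed.

Lemma agree_upto_cut s t N w1 w2 : (s%:E <= itime w1 N)%E -> (s%:E <= itime w2 N)%E ->
  agree_upto (s + t) w1 w2 -> agree_upto t (cut N s w1) (cut N s w2).
Proof.
move=> s1 s2 a m; have := a (N + m)%N; rewrite !(itime_cut _ s1) !(itime_cut _ s2).
rewrite EFinD !leeD2lE// => h /h /= [tE ->]; split => //.
by move: tE => /(congr1 (fun z => (z - s%:E)%E)); rewrite ![(s%:E + _)%E]addeC !addeK.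
Qed.

Lemma agree_upto_restart s t w1 w2 : 0 <= t -> agree_upto (s + t) w1 w2 ->
  agree_upto t (restart s w1) (restart s w2).
Proof.
move=> t0 a; rewrite /restart.
have cE : cnt w1 s = cnt w2 s.
  by apply: agree_before_cnt; apply: agree_before_upto a; rewrite lerDl.
rewrite -cE; apply: agree_upto_cut => //; first by rewrite leNgt -ltn_cnt ltnn.
by rewrite cE leNgt -ltn_cnt ltnn.
Qed.

Lemma agree_upto_pulse t z (Sz : S z) (z0 : z <> 0) w1 w2 : agree_upto t w1 w2 ->
  agree_upto t (pulse Sz z0 w1) (pulse Sz z0 w2).
Proof. by move=> a [|m] //=; exact: a. Qed.

(* What remains of [w] once its impulses at time 0 are overridden. *)
Definition drop0 w := cut (cntle w 0) 0 w.

Lemma itime_drop0 w m : itime w (cntle w 0 + m)%N = (0%:E + itime (drop0 w) m)%E.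
Proof. by apply: itime_cut; rewrite leNgt; apply/negP => /ltW; rewrite -ltn_cntle ltnn. Qed.

Lemma agree_upto_drop0 t w1 w2 : 0 <= t -> agree_upto t w1 w2 ->
  agree_upto t (drop0 w1) (drop0 w2).
Proof.
move=> t0 a; rewrite /drop0 -(agree_upto_cntle (agree_uptoW t0 a)).
apply: agree_upto_cut; last by rewrite add0r.
  by rewrite leNgt; apply/negP => /ltW; rewrite -ltn_cntle ltnn.
rewrite (agree_upto_cntle (agree_uptoW t0 a)).
by rewrite leNgt; apply/negP => /ltW; rewrite -ltn_cntle ltnn.
Qed.

End operations.
Arguments no_impulse {R n S}.

(** * Dynamic programming *)

Section abstract_game.
Context {R : realType} {n : nat} {S1 S2 : set 'rV[R]_n}.
Variable g : 'rV[R]_n -> control S1 -> control S2 -> \bar R.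
Implicit Types (x y : 'rV[R]_n) (u : control S1) (v : control S2).

(* The lower value is [value] of the gain; the upper value is the opposite of
   [value] of the opposite gain, with the players exchanged. *)
Definition value x : \bar R :=
  ereal_inf [set ereal_sup [set g x u (beta u) | u in [set: control S1]]
            | beta in [set beta : control S1 -> control S2 | nonanticipative beta]].

Lemma value_le x (beta : control S1 -> control S2) (r : \bar R) : nonanticipative beta ->
  (forall u, g x u (beta u) <= r)%E -> (value x <= r)%E.
Proof.
move=> nb gr; apply: (@le_trans _ _ (ereal_sup [set g x u (beta u) | u in [set: control S1]])).
  by apply: ereal_inf_lbound; exists beta.
by apply: ge_ereal_sup => _ [u _ <-].
Qed.

Lemma le_value x (r : \bar R) :
  (forall beta, nonanticipative beta -> exists u, r <= g x u (beta u))%E -> (r <= value x)%E.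
Proof.
move=> gr; apply: le_ereal_inf_tmp => _ [beta nb <-]; have [u ru] := gr beta nb.
by apply: (le_trans ru); apply: ereal_sup_ubound; exists u.
Qed.

Variable K : R.
Hypothesis gK : forall x u, (g x u no_impulse <= K%:E)%E.
Hypothesis Kg : forall x v, ((- K)%:E <= g x no_impulse v)%E.

(** Each player secures one of the bounds by remaining inactive, whatever the opponent does. *)
Lemma value_bounds x : ((- K)%:E <= value x <= K%:E)%E.
Proof.
apply/andP; split; last by apply: (value_le (beta := fun=> no_impulse)).
by apply: le_value => beta _; exists no_impulse.
Qed.

Lemma value_fin_num x : value x \is a fin_num.
Proof.
have /andP[lo up] := value_bounds x.
by rewrite fin_numE; apply/andP; split; apply/eqP => E; [move: lo|move: up]; rewrite E.
Qed.

Definition rvalue x : R := fine (value x).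

Lemma rvalueE x : value x = (rvalue x)%:E.
Proof. by rewrite fineK// value_fin_num. Qed.

Lemma norm_rvalue_le x : `|rvalue x| <= K.
Proof. by have := value_bounds x; rewrite rvalueE !lee_fin ler_norml. Qed.

Lemma exists_strategy x (e : R) : 0 < e -> exists beta : control S1 -> control S2,
  nonanticipative beta /\ forall u, (g x u (beta u) <= (rvalue x + e)%:E)%E.
Proof.
move=> e0; have [_ [beta nb <-] sb] := lb_ereal_inf_adherent e0 (value_fin_num x).
exists beta; split => // u.
have -> : ((rvalue x + e)%:E = value x + e%:E)%E by rewrite rvalueE.
apply: le_trans (ltW sb).
by apply: ereal_sup_ubound; exists u.
Qed.

Lemma exists_control x (beta : control S1 -> control S2) (e : R) : 0 < e ->
  nonanticipative beta -> exists u, ((rvalue x - e)%:E <= g x u (beta u))%E.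
Proof.
move=> e0 nb; apply: contrapT => /forallNP h.
have : (value x <= (rvalue x - e)%:E)%E.
  by apply: (value_le nb) => u; rewrite leNgt; apply/negP => /ltW; exact: h.
by rewrite rvalueE lee_fin; lra.
Qed.

(** A nearly optimal strategy at [y] is played at [x]. The assumption on [g] is an inequality
    between extended reals rather than a bound on a difference, as [g] may be infinite. *)
Lemma value_uniform_continuity :
  (forall e : R, 0 < e -> exists2 d, 0 < d & forall x y u v, `|x - y| <= d ->
     (g x u v <= g y u v + e%:E)%E) ->
  forall e : R, 0 < e -> exists2 d, 0 < d & forall x y, `|x - y| <= d ->
     `|rvalue x - rvalue y| <= e.
Proof.
move=> gc e e0; have e20 : 0 < e / 2 by rewrite divr_gt0.
have [d d0 gd] := gc _ e20; exists d => //.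
suff le x y : `|x - y| <= d -> rvalue x <= rvalue y + e.
  move=> x y xy; rewrite ler_distlC; apply/andP; split; last by rewrite le// distrC.
  by rewrite lerBlDr le.
move=> xy; rewrite -lee_fin -rvalueE.
have [beta [nb gb]] := exists_strategy y e20.
apply: (value_le nb) => u; apply: (le_trans (gd x y u (beta u) xy)).
have -> : ((rvalue y + e)%:E = (rvalue y + e / 2)%:E + (e / 2)%:E)%E.
  by rewrite -EFinD; congr EFin; lra.
by rewrite leeD2r.
Qed.

Section dynamic_programming.
Variables (s e : R) (P : 'rV[R]_n -> control S1 -> control S2 -> R).
Variable Y : 'rV[R]_n -> control S1 -> control S2 -> 'rV[R]_n.
Hypotheses (s0 : 0 <= s) (e0 : 0 < e) (e1 : e <= 1).
Hypothesis g_split : forall x u v,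
  g x u v = ((P x u v)%:E + e%:E * g (Y x u v) (restart s u) (restart s v))%E.
Hypothesis P_local : forall x u v u' v', agree_before s u u' -> agree_before s v v' ->
  P x u v = P x u' v'.
Hypothesis Y_local : forall x u v u' v', agree_before s u u' -> agree_before s v v' ->
  Y x u v = Y x u' v'.

(** The reply is [beta u] for a nearly optimal [beta]. After [s], facing a continuation [w], the
    strategy answers with what [beta] would do against [u] followed by [w]. By non-anticipation the
    past does not depend on [w], so this continuation is a competitor for the value at the state
    reached. *)
Lemma dpp_response x u (eps : R) : 0 < eps ->
  exists v, P x u v + e * rvalue (Y x u v) <= rvalue x + eps.
Proof.
move=> eps0; have [beta [nb gb]] := exists_strategy x eps0.
exists (beta u); rewrite -lerBrDl mulrC -ler_pdivlMr// -lee_fin -rvalueE.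
pose u1 (w : control S1) := glue s0 u w.
have au w : agree_before s (u1 w) u by exact: agree_before_glue.
have ab w : agree_before s (beta (u1 w)) (beta u).
  apply: agree_upto_before => t /andP[t0 ts]; apply: nb => //.
  exact: agree_before_ltW (au w).
apply: (value_le (beta := fun w => restart s (beta (u1 w)))) => [t w1 w2 t0 a|w].
  apply: agree_upto_restart => //; apply: nb; first by rewrite addr_ge0.
  exact: agree_upto_glue.
have := gb (u1 w); rewrite g_split (P_local _ (au w) (ab w)) (Y_local _ (au w) (ab w)).
rewrite {2}/u1 restart_glue; case: (g _ _ _) => [r| |].
- by rewrite -EFinM -EFinD !lee_fin => h; rewrite ler_pdivlMr//; lra.
- by rewrite gt0_muley ?lte_fin.
- by rewrite leNye.
Qed.

(** The strategy [bt] plays [v] before [s], then a nearly optimal strategy for the state reached.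
    That state depends on the past of [u] only, so [bt] is non-anticipative, and a control that is
    nearly optimal against it is the one sought. As [e <= 1], the second error [eps / 2] is not
    enlarged by discounting. *)
Lemma dpp_feedback x v (eps : R) : 0 < eps ->
  exists u, rvalue x - eps <= P x u v + e * rvalue (Y x u v).
Proof.
move=> eps0; have eps20 : 0 < eps / 2 by rewrite divr_gt0.
have /choice[beta bP] := fun y => exists_strategy y eps20.
pose bt u := glue s0 v (beta (Y x u v) (restart s u)).
have nbt : nonanticipative bt.
  move=> t u1 u2 t0 a; have [ts|st] := ltP t s.
    have h w := agree_before_ltW ts (@agree_before_glue _ _ _ _ s0 v w).
    by apply: agree_upto_trans (agree_upto_sym (h _)); exact: h.
  have YE : Y x u1 v = Y x u2 v by apply: Y_local => //; exact: agree_before_upto a.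
  rewrite -(subrKC s t); apply: agree_upto_glue; rewrite YE; apply: (bP _).1.
    by rewrite subr_ge0.
  by apply: agree_upto_restart; rewrite ?subr_ge0// subrKC.
have [u ux] := exists_control x eps20 nbt; exists u.
have au : agree_before s u u by [].
have ab : agree_before s (bt u) v by exact: agree_before_glue.
have := ux; rewrite g_split (P_local _ au ab) (Y_local _ au ab).
rewrite [bt u]/bt restart_glue => h.
have : ((rvalue x - eps / 2)%:E <= (P x u v)%:E + e%:E * (rvalue (Y x u v) + eps / 2)%:E)%E.
  apply: (le_trans h); rewrite leeD2l// lee_pmul2l ?lte_fin//; exact: (bP _).2.
rewrite -EFinM -EFinD lee_fin mulrDr => {}h.
have : e * (eps / 2) <= eps / 2 by rewrite ler_piMl// ltW.
by lra.
Qed.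

End dynamic_programming.
End abstract_game.

Section locality.
Context {R : realType} {n : nat} {U V : set 'rV[R]_n}.
Implicit Types (u : control U) (v : control V).

(** The last hypothesis places the removed impulses of [v] strictly before the remaining ones of
    [u], so that none of these was cancelled by a removed impulse. *)
Lemma effective_cut u u' v v' (s : R) Nu Nv :
  (forall m, itime u (Nu + m)%N = (s%:E + itime u' m)%E) ->
  (forall m, itime v (Nv + m)%N = (s%:E + itime v' m)%E) ->
  (forall m k, (k < Nv)%N -> (itime v k < itime u (Nu + m)%N)%E) ->
  forall m, effective u v (Nu + m)%N = effective u' v' m.
Proof.
move=> tu tv vu m; apply: asbool_equiv_eq; split => h k.
  by move=> uvE; apply: (h (Nv + k)%N); rewrite tu tv uvE.
have [kN|Nk] := ltnP k Nv; first by apply/eqP; rewrite gt_eqF// vu.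
rewrite -(subnKC Nk) tu tv => E; apply: (h (k - Nv)%N).
by move: E => /(congr1 (fun z => (z - s%:E)%E)); rewrite ![(s%:E + _)%E]addeC !addeK.
Qed.

Variables (s : R) (u u' : control U) (v v' : control V).
Hypotheses (au : agree_before s u u') (av : agree_before s v v').

Lemma effective_local m : (itime u m < s%:E)%E -> effective u v m = effective u' v' m.
Proof.
move=> us; have [uE _] := au (or_introl us).
apply: asbool_equiv_eq; split => h k E; apply: (h k).
  have vk : (itime v' k < s%:E)%E by rewrite -E -uE.
  by have [-> _] := av (or_intror vk); rewrite uE.
have vk : (itime v k < s%:E)%E by rewrite -E.
by have [<- _] := av (or_introl vk); rewrite -uE.
Qed.

Lemma jump_local t : t < s -> jump u v t = jump u' v' t.
Proof.
move=> ts; rewrite !jumpE.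
have aut := agree_before_ltW ts au; have avt := agree_before_ltW ts av.
rewrite (agree_before_cnt (agree_before_upto (lexx t) aut)) (agree_upto_cntle aut).
rewrite (agree_before_cnt (agree_before_upto (lexx t) avt)) (agree_upto_cntle avt).
have lt_s (S : set 'rV[R]_n) (w1 w2 : control S) m : agree_upto t w1 w2 ->
    (m < cntle w2 t)%N -> (itime w1 m < s%:E)%E.
  move=> a; rewrite -(agree_upto_cntle a) ltn_cntle => /le_lt_trans; apply.
  by rewrite lte_fin.
congr (_ + _); apply: eq_big_nat => m /andP[_ /lt_s].
  move=> /(_ _ aut) us; rewrite /effsize effective_local//.
  by have [_ ->] := au (or_introl us).
by move=> /(_ _ avt) vs; have [_ ->] := av (or_introl vs).
Qed.

Lemma paid_local (S : set 'rV[R]_n) (w w' : control S) (c : 'rV[R]_n -> R) (lam : R) p p' :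
  agree_before s w w' -> (forall m, (itime w m < s%:E)%E -> p m = p' m) ->
  paid c lam w p (cnt w s) = paid c lam w' p' (cnt w' s).
Proof.
move=> aw pE; rewrite /paid (agree_before_cnt aw); apply: eq_big_nat => m /=.
rewrite -(agree_before_cnt aw) ltn_cnt => ws.
by have [<- <-] := aw _ (or_introl ws); rewrite pE.
Qed.

End locality.

Section game.
Context {R : realType} {n : nat} {U V : set 'rV[R]_n}.
Variables (b : 'rV[R]_n -> 'rV[R]_n) (f c chi : 'rV[R]_n -> R) (lam M L F K : R).
Hypotheses (lam0 : 0 < lam) (L0 : 0 < L) (bM : forall y, `|b y| <= M)
  (bL : forall y z, `|b y - b z| <= L * `|y - z|)
  (fF : forall y, `|f y| <= F)
  (fK : forall y z, `|f y - f z| <= K * `|y - z|)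
  (c0 : forall z, U z -> 0 <= c z) (chi0 : forall z, V z -> 0 <= chi z).
Notation Y := (trajectory b).
Notation J := (gain b f c chi lam).
Implicit Types (u : control U) (v : control V) (x : 'rV[R]_n) (s t : R).

Definition pgain s x u v : R := flow_gain b f lam x u v s
  - paid c lam u (effective u v) (cnt u s) + paid chi lam v xpredT (cnt v s).

Lemma trajectory0 x u v : Y x u v 0 = x.
Proof. by have [] := trajectoryP L0 bM bL x u v. Qed.

Lemma trajectory_local s x u u' v v' t : agree_before s u u' -> agree_before s v v' ->
  0 <= t <= s -> Y x u v t = Y x u' v' t.
Proof.
move=> au av /andP[t0 ts].
apply: (trajectory_unique L0 bL (trajectoryP L0 bM bL x u v) (trajectoryP L0 bM bL x u' v')) => //.
by move=> r /andP[_ rt]; apply: jump_local au av _ _; exact: lt_le_trans ts.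
Qed.

Lemma pgain_local s x u u' v v' : agree_before s u u' -> agree_before s v v' ->
  pgain s x u v = pgain s x u' v'.
Proof.
move=> au av; rewrite /pgain (paid_local chi lam av (p' := xpredT))//.
rewrite (paid_local c lam au (p' := effective u' v')); last first.
  by move=> m us; exact: effective_local au av _ us.
congr (_ - _ + _); apply: eq_Rintegral => t; rewrite inE/= in_itv/= => /andP[t0 ts].
by rewrite /integrand (trajectory_local x au av)// t0 ltW.
Qed.

(** The remaining game starts from the state just before the impulses at [s]. These become the
    impulses at time 0 of the restarted controls, so the two jumps coincide. *)
Lemma gain_split s x u v : 0 <= s ->
  J x u v = ((pgain s x u v)%:E + (expR (- lam * s))%:E * J (Y x u v s) (restart s u) (restart s v))%E.
Proof.
move=> s0.
have le_s (S : set 'rV[R]_n) (w : control S) m : (m < cnt w s)%N -> (itime w m <= s%:E)%E.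
  by rewrite ltn_cnt => /ltW.
have effs m : effective u v (cnt u s + m)%N = effective (restart s u) (restart s v) m.
  move: m; apply: effective_cut; [exact: itime_restart|exact: itime_restart|].
  move=> m k; rewrite ltn_cnt => /lt_le_trans; apply.
  by rewrite itime_restart leeDl// itime_ge0.
apply: (gain_cut lam0 L0 bM bL fF fK c0 chi0 s0) => //; try exact: itime_restart; try exact: le_s.
congr (_ + _); rewrite !jumpE !(cnt_le0 _ (lexx 0)).
have E (S : set 'rV[R]_n) (w : control S) : cntle w s = (cnt w s + cntle (restart s w) 0)%N.
  by rewrite -{1}(addr0 s); apply: cntle_cut => //; [exact: itime_restart|exact: le_s].
rewrite !E -{1}[cnt u s]add0n -{1}[cnt v s]add0n !big_addn !addKn.
congr (_ + _); apply: eq_bigr => m _; rewrite addnC//.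
by rewrite /effsize effs.
Qed.

(** The pulse cancels every impulse of [u] at time 0: these neither move the state nor cost
    anything, and what remains is [drop0 u]. The cut is made at time 0, with [cntle u 0] impulses on
    one side and the pulse on the other. *)
Lemma gain_pulse x u v eta (Veta : V eta) (eta0 : eta <> 0) :
  J x u (pulse Veta eta0 v) = ((chi eta)%:E + J (x + eta) (drop0 u) v)%E.
Proof.
have le0 m : (m < cntle u 0)%N -> (itime u m <= 0%:E)%E by rewrite ltn_cntle.
have tp m : itime (pulse Veta eta0 v) (1 + m)%N = (0%:E + itime v m)%E by rewrite add0e.
have pu m k : (k < 1)%N -> (itime (pulse Veta eta0 v) k < itime u (cntle u 0 + m)%N)%E.
  case: k => // _ /=; rewrite ltNge -[leRHS]/(0%:E) -ltn_cntle.
  by rewrite -leqNgt leq_addr.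
have p1 m : (m < 1)%N -> (itime (pulse Veta eta0 v) m <= 0%:E)%E by case: m.
have ineff m : (m < cntle u 0)%N -> effective u (pulse Veta eta0 v) m = false.
  move=> /le0 um; apply/asboolPn => /(_ 0%N); apply => /=.
  by apply/le_anti; rewrite um itime_ge0.
have eff := effective_cut (itime_drop0 u) tp pu.
rewrite (@gain_cut _ _ _ _ b f c chi lam M L F K lam0 L0 bM bL fF fK c0 chi0
  u (drop0 u) _ v x (x + eta) 0 (cntle u 0) 1)//; last 2 first.
- exact: itime_drop0.
- rewrite trajectory0 -addrA; congr (_ + _).
  rewrite !jumpE !(cnt_le0 _ (lexx 0)) big_nat_cond big1 ?add0r; last first.
    by move=> m /andP[/andP[_ mN] _]; rewrite /effsize ineff// scale0r.
  have cp : cntle (pulse Veta eta0 v) 0 = (cntle v 0).+1.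
    by rewrite -{1}(addr0 0) (cntle_cut tp p1).
  have cd : cntle (drop0 u) 0 = 0%N.
    have := cntle_cut (itime_drop0 u) le0 (lexx 0); rewrite addr0.
    by move=> /eqP; rewrite -[X in X == _]addn0 eqn_add2l => /eqP.
  by rewrite cp cd [X in _ = _ + (X + _)]big_geq// add0r big_nat_recl.
rewrite mulr0 expR0 mul1e; congr (_%:E + _)%E.
rewrite /flow_gain set_itvco0 Rintegral_set0 add0r /paid big_nat_cond big1 ?oppr0 ?add0r.
  by rewrite big_nat1/= mulr0 expR0 !mulr1.
by move=> m /andP[/andP[_ mN] _]; rewrite ineff// mulr0.
Qed.

End game.

Section game_values.
Context {R : realType} {n : nat} {U V : set 'rV[R]_n}.
Variables (b : 'rV[R]_n -> 'rV[R]_n) (f c chi : 'rV[R]_n -> R) (lam M L F K : R).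
Hypotheses (lam0 : 0 < lam) (L0 : 0 < L) (bM : forall y, `|b y| <= M)
  (bL : forall y z, `|b y - b z| <= L * `|y - z|)
  (fF : forall y, `|f y| <= F)
  (fK : forall y z, `|f y - f z| <= K * `|y - z|)
  (c0 : forall z, U z -> 0 <= c z) (chi0 : forall z, V z -> 0 <= chi z).
Notation Y := (trajectory b).
Notation J := (gain b f c chi lam).
Notation G := (pgain b f c chi lam).
Implicit Types (u : control U) (v : control V) (x : 'rV[R]_n) (s t : R).

(** Everything the viscosity inequalities need, free of strategies and of infinite quantities. There
    is no counterpart of [gv_pulse] for player-xi, whose immediate impulse may be cancelled. *)
Record game_value (W : 'rV[R]_n -> R) : Prop := GameValue {
  gv_bounded : forall x, `|W x| <= F / lam ;
  gv_uniform : forall e : R, 0 < e -> exists2 d, 0 < d &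
    forall x y, `|x - y| <= d -> `|W x - W y| <= e ;
  gv_pulse : forall x eta, V eta -> W x <= W (x + eta) + chi eta ;
  gv_response : forall x u s (e : R), 0 <= s -> 0 < e ->
    exists v, G s x u v + expR (- lam * s) * W (Y x u v s) <= W x + e ;
  gv_feedback : forall x s (e : R), 0 <= s -> 0 < e ->
    exists u, W x - e <= G s x u (no_impulse : control V)
      + expR (- lam * s) * W (Y x u (no_impulse : control V) s) }.

Lemma no_impulse_cost (S : set 'rV[R]_n) (h : 'rV[R]_n -> R) p m :
  cost_term h lam (no_impulse : control S) p m = 0%E.
Proof. by rewrite /cost_term/= gt0_muley ?lte_fin//= mule0 mul0e. Qed.

Lemma gain_no_impulse_u x v : ((- (F / lam))%:E <= J x (no_impulse : control U) v)%E.
Proof.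
rewrite (gainE c chi lam0 L0 bM bL fF fK) [X in (_ - X + _)%E]eseries0; last first.
  by move=> m _ _; exact: no_impulse_cost.
rewrite sube0 -[leLHS]adde0 leeD//; last first.
  by apply: nneseries_ge0 => k _ _; exact: cost_term_ge0.
have := norm_running_le lam0 L0 bM bL fF fK x (no_impulse : control U) v.
by rewrite lee_fin ler_norml => /andP[].
Qed.

Lemma gain_no_impulse_v x u : (J x u (no_impulse : control V) <= (F / lam)%:E)%E.
Proof.
rewrite (gainE c chi lam0 L0 bM bL fF fK) [X in (_ + X)%E]eseries0; last first.
  by move=> m _ _; exact: no_impulse_cost.
rewrite adde0 -[leRHS]sube0 leeB//; last first.
  by apply: nneseries_ge0 => k _ _; exact: cost_term_ge0.
have := norm_running_le lam0 L0 bM bL fF fK x u (no_impulse : control V).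
by rewrite lee_fin ler_norml => /andP[].
Qed.

Lemma gain_uniform_continuity (e : R) : 0 < e -> exists2 d, 0 < d &
  forall x y u v, `|x - y| <= d -> (J x u v <= J y u v + e%:E)%E.
Proof.
move=> e0; have [d d0 rd] := @running_uniform_continuity _ _ U V _ _ _ _ _ _ _ lam0 L0 bM bL fF fK e e0.
exists d => // x y u v xy; rewrite !(gainE c chi lam0 L0 bM bL fF fK).
have := rd _ _ u v xy; rewrite ler_norml => /andP[_ h].
rewrite [leRHS]addeAC leeD2r// [leRHS]addeAC leeD2r// -EFinD lee_fin.
by rewrite -lerBlDl.
Qed.

Lemma expR_le1N s : 0 <= s -> expR (- lam * s) <= 1.
Proof. by move=> s0; rewrite -[leRHS]expR0 ler_expR mulNr oppr_le0 mulr_ge0// ltW. Qed.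

(** The set [V] may contain 0, which is not an admissible impulse but does enter [H_inf]; there the
    inequality is the nonnegativity of [chi]. *)
Lemma ler_pulse (W : 'rV[R]_n -> R) :
  (forall x eta (e : R), V eta -> eta <> 0 -> 0 < e -> W x <= W (x + eta) + chi eta + e) ->
  forall x eta, V eta -> W x <= W (x + eta) + chi eta.
Proof.
move=> h x eta Veta; have [eta0|/eqP eta0] := eqVneq eta 0.
  by rewrite {1}eta0 addr0 lerDl; exact: chi0.
by apply/ler_addgt0Pr => e e0; exact: h.
Qed.

Lemma lower_game_value : (forall x, lower_value b f c chi lam U V x \is a fin_num) /\
  game_value (fun x => fine (lower_value b f c chi lam U V x)).
Proof.
have vE x : lower_value b f c chi lam U V x = value (fun x u v => J x u v) x by [].
have hJ := gain_no_impulse_v; have Jh := gain_no_impulse_u.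
split; first by move=> x; rewrite vE; exact: value_fin_num hJ Jh x.
split.
- by move=> x; exact: (norm_rvalue_le hJ Jh x).
- exact: (value_uniform_continuity hJ Jh gain_uniform_continuity).
- apply: ler_pulse => // x eta e Veta eta0 e0.
  have [beta [nb gb]] := exists_strategy hJ Jh (x + eta) e0.
  rewrite -lee_fin -(rvalueE hJ Jh).
  (* Player-eta jumps by [eta] at once, then follows a nearly optimal strategy at [x + eta] against
     the impulses of [u] that survive. *)
  apply: (value_le (beta := fun u => pulse Veta eta0 (beta (drop0 u)))).
    move=> t u1 u2 t0 a; apply: agree_upto_pulse; apply: nb => //.
    exact: agree_upto_drop0.
  move=> u; rewrite (gain_pulse lam0 L0 bM bL fF fK c0 chi0).
  apply: (le_trans (leeD2l _ (gb _))).
  by rewrite -EFinD lee_fin [leRHS]addrAC [leLHS]addrC; exact: lexx.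
- move=> x u s e s0 e0.
  apply: (dpp_response hJ Jh (P := G s) (Y := fun x u v => Y x u v s) s0) => //.
  + exact: expR_gt0.
  + by move=> *; exact: (gain_split lam0 L0 bM bL fF fK c0 chi0).
  + by move=> y u1 v1 u2 v2 au av; exact: (pgain_local f c chi lam L0 bM bL y au av).
  + by move=> y u1 v1 u2 v2 au av; apply: (trajectory_local L0 bM bL y au av); rewrite s0 lexx.
- move=> x s e s0 e0.
  apply: (dpp_feedback hJ Jh (P := G s) (Y := fun x u v => Y x u v s) s0) => //.
  + exact: expR_gt0.
  + exact: expR_le1N.
  + by move=> *; exact: (gain_split lam0 L0 bM bL fF fK c0 chi0).
  + by move=> y u1 v1 u2 v2 au av; exact: (pgain_local f c chi lam L0 bM bL y au av).
  + by move=> y u1 v1 u2 v2 au av; apply: (trajectory_local L0 bM bL y au av); rewrite s0 lexx.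
Qed.

Let dual x v u : \bar R := (- J x u v)%E.

Lemma upper_valueE x : upper_value b f c chi lam U V x = (- value dual x)%E.
Proof.
rewrite /upper_value /value /ereal_inf oppeK; congr ereal_sup.
apply/seteqP; split => z /=.
  move=> [alpha na <-].
  exists (ereal_sup [set dual x v (alpha v) | v in setT]); first by exists alpha.
  by congr (- ereal_sup _)%E; rewrite image_comp.
move=> [_ [alpha na <-] <-]; exists alpha => //.
by congr (- ereal_sup _)%E; rewrite image_comp.
Qed.

(** Exchanging the players exchanges the two halves of dynamic programming: here [gv_response] comes
    from [dpp_feedback] and [gv_feedback] from [dpp_response], both for the opposite gain. *)
Lemma upper_game_value : (forall x, upper_value b f c chi lam U V x \is a fin_num) /\
  game_value (fun x => fine (upper_value b f c chi lam U V x)).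
Proof.
have lin1 (a a' q r : R) : a' - r - q <= a -> - a <= - a' + q + r by lra.
have lin2 (a p q w r : R) : a - r <= - p + q * w -> p + q * - w <= - a + r by lra.
have lin3 (a p q w r : R) : - p + q * w <= a + r -> - a - r <= p + q * - w by lra.
have hJ x v : (dual x v no_impulse <= (F / lam)%:E)%E.
  by rewrite leeNl -EFinN; exact: gain_no_impulse_u.
have Jh x u : ((- (F / lam))%:E <= dual x no_impulse u)%E.
  by rewrite EFinN leeN2; exact: gain_no_impulse_v.
have WE x : fine (upper_value b f c chi lam U V x) = - rvalue dual x.
  by rewrite upper_valueE fineN.
have E : (fun x => fine (upper_value b f c chi lam U V x)) = (fun x => - rvalue dual x).
  exact/funext.
split; first by move=> x; rewrite upper_valueE fin_numN; exact: value_fin_num hJ Jh x.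
have P_dual s x v u v' u' : agree_before s v v' -> agree_before s u u' ->
    - G s x u v = - G s x u' v'.
  by move=> av au; rewrite (pgain_local f c chi lam L0 bM bL x au av).
have Y_dual s (s0 : 0 <= s) x v u v' u' : agree_before s v v' -> agree_before s u u' ->
    Y x u v s = Y x u' v' s.
  by move=> av au; apply: (trajectory_local L0 bM bL x au av); rewrite s0 lexx.
have dual_split s (s0 : 0 <= s) x v u :
    dual x v u = ((- G s x u v)%:E + (expR (- lam * s))%:E * dual (Y x u v s) (restart s v) (restart s u))%E.
  rewrite /dual (gain_split lam0 L0 bM bL fF fK c0 chi0 x u v s0).
  by rewrite oppeD ?fin_num_adde_defr// muleN EFinN.
rewrite E; split.
- by move=> x; rewrite normrN; exact: (norm_rvalue_le hJ Jh x).
- have dual_uc (e : R) : 0 < e -> exists2 d, 0 < d & forall x y v u, `|x - y| <= d ->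
      (dual x v u <= dual y v u + e%:E)%E.
    move=> e0; have [d d0 gd] := gain_uniform_continuity e0.
    exists d => // x y v u xy; rewrite /dual -leeBlDr// -fin_num_oppeD// leeN2.
    by apply: gd; rewrite distrC.
  move=> e e0; have [d d0 vd] := value_uniform_continuity hJ Jh dual_uc e0.
  by exists d => // x y xy; rewrite -opprD normrN; exact: vd.
- apply: ler_pulse => // x eta e Veta eta0 e0.
  apply: lin1.
  rewrite -lee_fin -(rvalueE hJ Jh); apply: le_value => alpha na.
  (* A strategy [alpha] at [x], observed after player-eta has opened with the pulse, induces this
     strategy at [x + eta]; a control that is good against it, preceded by the pulse, is good
     against [alpha]. *)
  pose alpha' v := drop0 (alpha (pulse Veta eta0 v)).
  have na' : nonanticipative alpha'.
    move=> t v1 v2 t0 a; apply: agree_upto_drop0 => //; apply: na => //.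
    exact: agree_upto_pulse.
  have [v hv] := exists_control hJ Jh (x + eta) e0 na'.
  exists (pulse Veta eta0 v); rewrite /dual (gain_pulse lam0 L0 bM bL fF fK c0 chi0).
  by rewrite oppeD ?fin_num_adde_defr// addeC EFinB leeD2r.
- move=> x u s e s0 e0.
  have [v hv] := dpp_feedback hJ Jh s0 (expR_gt0 _) (expR_le1N s0) (dual_split s s0)
    (P_dual s) (Y_dual s s0) x u e0.
  by exists v; exact: lin2.
- move=> x s e s0 e0.
  have [u hu] := dpp_response hJ Jh s0 (expR_gt0 _) (dual_split s s0)
    (P_dual s) (Y_dual s s0) x no_impulse e0.
  by exists u; exact: lin3.
Qed.

End game_values.

(** * The viscosity inequalities *)

Section expansions.
Context {R : realType} {n : nat}.
Implicit Types (x y p : 'rV[R]_n) (W phi : 'rV[R]_n -> R).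

Lemma norm_dotp_le p y : `|dotp p y| <= (\sum_i `|p 0 i|) * `|y|.
Proof.
rewrite /dotp (le_trans (ler_norm_sum _ _ _))// mulr_suml; apply: ler_sum => i _.
by rewrite normrM ler_wpM2l// ler_norm_entry.
Qed.

Lemma dotpD p y z : dotp p (y + z) = dotp p y + dotp p z.
Proof.
by rewrite /dotp -big_split; apply: eq_bigr => i _; rewrite !mxE mulrDr.
Qed.

Lemma dotpZ p y (a : R) : dotp p (a *: y) = a * dotp p y.
Proof.
by rewrite /dotp mulr_sumr; apply: eq_bigr => i _; rewrite !mxE mulrCA.
Qed.

Lemma diff_dotp phi x y : differentiable phi x -> 'd phi x y = dotp (grad phi x) y.
Proof.
move=> dphi; rewrite [in LHS](row_sum_delta y) linear_sum/=; apply: eq_bigr => i _.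
by rewrite linearZ/= mxE mulrC.
Qed.

Lemma grad_opp phi x : differentiable phi x -> grad (- phi) x = - grad phi x.
Proof.
move=> dphi; apply/rowP => i; rewrite !mxE diffN//.
Qed.

Lemma diff_expansion phi x (e : R) : differentiable phi x -> 0 < e ->
  \forall y \near x, phi y <= phi x + dotp (grad phi x) (y - x) + e * `|y - x|.
Proof.
move=> dphi e0; have /diff_locallyP[_ /eqaddoP/(_ e e0)] := dphi.
move=> h; rewrite (near_shift 0); apply: filterS h => y; rewrite /= subr0 addrK.
rewrite -diff_dotp// => h; have := le_trans (ler_norm _) h.
rewrite -[X in X <= _]/(phi (y + x) - (phi x + 'd phi x y)) lerBlDr.
by rewrite [e * _ + _]addrC.
Qed.

Lemma expR_bounds (s : R) : 0 <= s -> 0 <= expR (- s) - (1 - s) <= s ^+ 2.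
Proof.
move=> s0; apply/andP; split; first by rewrite subr_ge0; exact: expR_ge1Dx.
have s1 : 0 < 1 + s by rewrite ltr_wpDr.
have : expR (- s) <= (1 + s)^-1.
  by rewrite expRN lef_pV2 ?posrE ?expR_gt0// expR_ge1Dx.
move=> /le_trans h; rewrite lerBlDr; apply: h.
rewrite -[leLHS]mul1r ler_pdivrMr//.
(* The claim reduces to [1 <= (1 - s + s ^+ 2) * (1 + s)], whose right-hand side is [1 + s ^+ 3]. *)
have : 0 <= s ^+ 3 by rewrite exprn_ge0.
by rewrite !exprS expr0; lra.
Qed.

(** Here [w] and [wy] are the values at [x] and at the displaced point, [e] is the discount and
    [kap] the supposed excess. After substitution, [s * kap] is at most the sum of the terms in
    [s ^+ 2] and of [s * (eps * B)], each at most [s * (kap / 4)]: a contradiction. *)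
Lemma hj_arith (w f0 D lam C A B eps s e wy r kap : R) :
  0 < s -> 0 <= B -> 0 <= C -> 0 <= A -> 0 < eps -> 0 < lam ->
  0 <= e -> e <= 1 -> 0 <= e - (1 - lam * s) -> e - (1 - lam * s) <= (lam * s) ^+ 2 ->
  w <= r + e * wy + s ^+ 2 -> r <= s * f0 + C * s ^+ 2 ->
  wy <= w + s * D + (A * (C * s ^+ 2) + eps * (s * B + C * s ^+ 2)) ->
  (C + 1 + lam ^+ 2 * `|w| + lam * `|D| + A * C + eps * C) * s <= kap / 4 ->
  eps * B <= kap / 4 -> 0 < kap -> kap = lam * w - D - f0 -> False.
Proof.
move=> s0 B0 C0 A0 eps0 lam0 e0 e1 le1 le2 hw hr hy hQ hB kap0 kapE.
have T0 : 0 <= A * (C * s ^+ 2) + eps * (s * B + C * s ^+ 2).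
  have s2 : 0 <= s ^+ 2 by exact: sqr_ge0.
  have sB : 0 <= s * B by rewrite mulr_ge0// ltW.
  have Cs : 0 <= C * s ^+ 2 by exact: mulr_ge0.
  by rewrite addr_ge0 ?(mulr_ge0 A0)// mulr_ge0 ?addr_ge0// ltW.
set T := A * _ + _ in hy T0.
have h1 : e * wy <= e * (w + s * D) + T.
  rewrite (le_trans (ler_wpM2l e0 hy))// mulrDr lerD2l ler_piMl//.
have h2 : e * w <= w - lam * s * w + (lam * s) ^+ 2 * `|w|.
  suff : (e - (1 - lam * s)) * w <= (lam * s) ^+ 2 * `|w| by lra.
  rewrite (le_trans (ler_norm _))// normrM ler_wpM2r// ger0_norm//.
have h3 : e * (s * D) <= s * D + lam * s ^+ 2 * `|D|.
  suff : (e - 1) * (s * D) <= lam * s ^+ 2 * `|D| by lra.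
  rewrite (le_trans (ler_norm _))// !normrM mulrA ler_wpM2r// (gtr0_norm s0) expr2 mulrA.
  rewrite ler_pM2r// ler0_norm ?subr_le0//; move: le1; clear; lra.
have h4 : s * ((C + 1 + lam ^+ 2 * `|w| + lam * `|D| + A * C + eps * C) * s) <= s * (kap / 4).
  by rewrite ler_wpM2l// ltW.
have h5 : s * (eps * B) <= s * (kap / 4) by rewrite ler_wpM2l// ltW.
have h6 : 0 < s * kap by rewrite mulr_gt0.
have h7 : s * kap = s * (lam * w - D - f0) by rewrite kapE.
move: h1 h2 h3 h4 h5 h6 h7 hw hr; rewrite /T.
move: `|w| `|D| => aw aD; clear; lra.
Qed.

(** A lower bound on the continuation value, tested from above by [phi], contradicts a positive
    left-hand side once divided by [s]. The subsolution inequality uses it as it stands, the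
    supersolution inequality for the opposites of [W], [phi] and [f]. *)
Lemma hj_limit W phi x p (f0 lam C : R) : 0 < lam -> 0 <= C ->
  differentiable phi x -> W x = phi x -> (\forall z \near x, W z <= phi z) ->
  (\forall s \near (0 : R)^'+, exists r y,
     [/\ W x <= r + expR (- lam * s) * W y + s ^+ 2, r <= s * f0 + C * s ^+ 2
       & `|y - (x + s *: p)| <= C * s ^+ 2]) ->
  lam * W x - dotp (grad phi x) p - f0 <= 0.
Proof.
move=> lam0 C0 dphi Wphi Wnear hs; rewrite leNgt; apply/negP.
set D := dotp _ _; set kap := _ - _ - _ => kap0.
(* The dual of the max norm is the sum norm, hence [A] for the gradient. *)
pose A := \sum_i `|grad phi x 0 i|; pose B := `|p|.
have A0 : 0 <= A by apply: sumr_ge0.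
pose eps := kap / (4 * (B + 1)).
have B1 : 0 < B + 1 by rewrite ltr_wpDl// normr_ge0.
have eps0 : 0 < eps by rewrite divr_gt0// mulr_gt0.
have epsB : eps * B <= kap / 4.
  rewrite (@le_trans _ _ (eps * (B + 1)))//.
    by rewrite ler_wpM2l ?lerDl// ltW.
  by rewrite /eps le_eqVlt; apply/orP; left; apply/eqP; field; rewrite gt_eqF.
have nb : \forall z \near x, W z <= W x + dotp (grad phi x) (z - x) + eps * `|z - x|.
  near=> z; rewrite Wphi (@le_trans _ _ (phi z))//; first by near: z.
  by near: z; exact: diff_expansion.
have [rho /= rho0 hrho] := (nbhs_ballP _ _).1 nb.
pose Q := C + 1 + lam ^+ 2 * `|W x| + lam * `|D| + A * C + eps * C.
have Q0 : 0 < Q.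
  have q1 : 0 <= lam ^+ 2 * `|W x| by rewrite mulr_ge0// sqr_ge0.
  have q2 : 0 <= lam * `|D| by rewrite mulr_ge0// ltW.
  have q3 : 0 <= A * C by exact: mulr_ge0.
  have q4 : 0 <= eps * C by rewrite mulr_ge0// ltW.
  by rewrite /Q; move: C0 q1 q2 q3 q4; clear; lra.
have BC0 : 0 < B + C + 1 by rewrite ltr_wpDl// addr_ge0// normr_ge0.
have kQ : 0 < kap / 4 / Q by apply: divr_gt0 => //; exact: divr_gt0.
near (0 : R)^'+ => s.
have s0 : 0 < s by near: s; exact: nbhs_right_gt.
have s1 : s <= 1 by near: s; apply: nbhs_right_le.
have srho : s < rho / (B + C + 1) by near: s; apply: nbhs_right_lt; rewrite divr_gt0.
have sQ : s <= kap / 4 / Q by near: s; exact: nbhs_right_le.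
have [r [y [h1 h2 h3]]] : exists r y,
     [/\ W x <= r + expR (- lam * s) * W y + s ^+ 2, r <= s * f0 + C * s ^+ 2
       & `|y - (x + s *: p)| <= C * s ^+ 2] by near: s.
have yx : y - x = s *: p + (y - (x + s *: p)) by rewrite opprD addrCA [s *: p + _]addrC subrK.
have nyx : `|y - x| <= s * B + C * s ^+ 2.
  by rewrite yx (le_trans (ler_normD _ _))// lerD// normrZ gtr0_norm.
have s2 : s ^+ 2 <= s by rewrite expr2 ler_piMl// ltW.
have By : W y <= W x + dotp (grad phi x) (y - x) + eps * `|y - x|.
  apply: hrho; rewrite -ball_normE/= distrC (le_lt_trans nyx)//.
  rewrite (@le_lt_trans _ _ ((B + C + 1) * s))//; last by rewrite mulrC -ltr_pdivlMr.
  have : C * s ^+ 2 <= C * s by rewrite ler_wpM2l.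
  by move: s0; clear; lra.
have lams : 0 <= lam * s by rewrite mulr_ge0// ltW.
have /andP[le1 le2] := expR_bounds lams.
apply: (@hj_arith (W x) f0 D lam C A B eps s (expR (- lam * s)) (W y) r kap) => //.
- exact: normr_ge0.
- by rewrite -[leRHS]expR0 ler_expR mulNr oppr_le0.
- by rewrite mulNr.
- by rewrite mulNr.
- rewrite (le_trans By)// -addrA -[leRHS]addrA lerD2l yx dotpD dotpZ -/D -addrA lerD2l.
  rewrite -yx lerD//; last by rewrite ler_wpM2l// ltW.
  rewrite (le_trans (ler_norm _))// (le_trans (norm_dotp_le _ _))// ler_wpM2l//.
- by rewrite mulrC -ler_pdivlMr// mulrC.
Unshelve. all: by end_near. Qed.

End expansions.

(** * Gain and displacement over a short time *)

Section small_times.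
Context {R : realType} {n : nat} {U V : set 'rV[R]_n}.
Variables (b : 'rV[R]_n -> 'rV[R]_n) (f c chi : 'rV[R]_n -> R) (lam M L F K : R).
Hypotheses (lam0 : 0 < lam) (L0 : 0 < L) (K0 : 0 <= K) (bM : forall y, `|b y| <= M)
  (bL : forall y z, `|b y - b z| <= L * `|y - z|)
  (fF : forall y, `|f y| <= F)
  (fK : forall y z, `|f y - f z| <= K * `|y - z|)
  (c0 : forall z, U z -> 0 <= c z) (chi0 : forall z, V z -> 0 <= chi z).
Notation Y := (trajectory b).
Notation G := (pgain b f c chi lam).
Notation mu := (@lebesgue_measure R).
Implicit Types (u : control U) (v : control V) (x : 'rV[R]_n) (s t : R).

Let F0 : 0 <= F. Proof. exact: le_trans (fF 0). Qed.
Let M0 : 0 <= M. Proof. exact: le_trans (bM 0). Qed.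

Lemma flow_gain_dist_le x u v s (a A : R) : 0 <= s ->
  (forall t, 0 <= t < s -> `|integrand b f lam x u v t - a| <= A) ->
  `|flow_gain b f lam x u v s - s * a| <= A * s.
Proof.
move=> s0 hA.
have mus : mu `[0, s[ = s%:E.
  rewrite lebesgue_measure_itv/= lte_fin sube0; case: ltP => // s0'.
  by rewrite (@le_anti _ _ s 0) ?s0 ?s0'.
have ih : mu.-integrable `[0, s[ (EFin \o integrand b f lam x u v).
  apply: (integrable_integrandS lam0 L0 bM bL fF fK x u v).
  by apply: subset_itvl; rewrite bnd_simp.
have ia : mu.-integrable `[0, s[ (EFin \o (fun=> a)).
  apply: measurable_bounded_integrable => //; first by rewrite [X in (X < _)%E]mus ltry.
  by exists `|a|; split; [exact: num_real|move=> N aN t _; exact: ltW].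
have -> : s * a = \int[mu]_(t in `[0, s[) a.
  by rewrite Rintegral_cst// [X in fine X]mus mulrC.
rewrite /flow_gain -RintegralB//.
have -> : A * s = A * fine (mu `[0, s[) by rewrite mus.
apply: norm_Rintegral_le => //.
- by apply: eq_integrable (integrableB _ ih ia) => //.
- by rewrite mus ltry.
Qed.

Lemma norm_flow_gain_le x u v s : 0 <= s -> `|flow_gain b f lam x u v s| <= F * s.
Proof.
move=> s0; rewrite -[X in `|X|]subr0 -[X in _ - X](mulr0 s).
apply: flow_gain_dist_le => // t /andP[t0 _]; rewrite subr0.
rewrite (le_trans (norm_integrand_le b lam fF _ _ _ _))// ler_piMr//.
by rewrite -[leRHS]expR0 ler_expR mulNr oppr_le0 mulr_ge0// ltW.
Qed.

Lemma no_impulse_before_cnt (S : set 'rV[R]_n) (w : control S) s t :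
  cnt w s = 0%N -> t < s -> forall m, itime w m <> t%:E.
Proof.
move=> w0 ts m wm; have : (m < cnt w s)%N by rewrite ltn_cnt wm lte_fin.
by rewrite w0.
Qed.

Lemma cnt_eq0_le (S : set 'rV[R]_n) (w : control S) s t :
  cnt w s = 0%N -> t <= s -> cnt w t = 0%N.
Proof. by move=> w0 ts; apply/eqP; rewrite -leqn0 -w0 cnt_homo. Qed.

Lemma norm_trajectory_before_le x u v s t : cnt u s = 0%N -> cnt v s = 0%N ->
  0 <= t <= s -> `|Y x u v t - x| <= M * t.
Proof.
move=> u0 v0 /andP[t0 ts].
have := trajectory_displacement L0 bM bL x u v t0.
by rewrite /cum (cnt_eq0_le u0 ts) (cnt_eq0_le v0 ts) !big_geq// !addr0.
Qed.

(** The term [K * M] comes from the motion of the state, [F * lam] from the discount. *)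
Lemma flow_gain_expansion x u v s : 0 <= s -> cnt u s = 0%N -> cnt v s = 0%N ->
  `|flow_gain b f lam x u v s - s * f x| <= (K * M + F * lam) * s ^+ 2.
Proof.
move=> s0 u0 v0; rewrite expr2 mulrA; apply: flow_gain_dist_le => // t /andP[t0 ts].
have hY : `|Y x u v t - x| <= M * t.
  by apply: (norm_trajectory_before_le _ u0 v0); rewrite t0 ltW.
have lamt : 0 <= lam * t by rewrite mulr_ge0// ltW.
have e1 : `|expR (- lam * t) - 1| <= lam * s.
  rewrite ler0_norm; last first.
    by rewrite subr_le0 -[leRHS]expR0 ler_expR mulNr oppr_le0.
  have /andP[h _] := expR_bounds lamt; rewrite mulNr.
  have : lam * t <= lam * s by rewrite ler_wpM2l// ltW.
  by lra.
have -> : integrand b f lam x u v t - f x =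
    f (Y x u v t) * (expR (- lam * t) - 1) + (f (Y x u v t) - f x).
  by rewrite /integrand; ring.
rewrite (le_trans (ler_normD _ _))// addrC mulrDl lerD//.
  rewrite (le_trans (fK _ _))// -mulrA ler_wpM2l// (le_trans hY)// ler_wpM2l// ltW//.
by rewrite normrM -mulrA ler_pM.
Qed.

(** Mean value theorem in each coordinate: the increment is [s] times a coordinate of [b] at some
    earlier state, itself within [M * s] of [x]. *)
Lemma trajectory_expansion x u v s : 0 < s -> cnt u s = 0%N -> cnt v s = 0%N ->
  `|Y x u v s - (x + s *: b x)| <= L * M * s ^+ 2.
Proof.
move=> s0 u0 v0; have [y0 yl yr yd] := trajectoryP L0 bM bL x u v.
have nu t : t < s -> forall m, itime u m <> t%:E by exact: no_impulse_before_cnt.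
have nv t : t < s -> forall m, itime v m <> t%:E by exact: no_impulse_before_cnt.
have cY : {within `[0, s], continuous (Y x u v)}.
  have yr0 t : 0 <= t -> t < s -> Y x u v r @[r --> t^'+] --> Y x u v t.
    move=> t0 ts; have := yr t t0.
    by rewrite (jump_eq0 (nu t ts) (nv t ts)) addr0.
  apply/continuous_within_itvP => //; split.
  - move=> t; rewrite in_itv/= => /andP[t0 ts]; apply/left_right_continuousP.
    by split; [exact: yl|apply: yr0 => //; exact: ltW].
  - exact: yr0.
  - exact: yl.
have LM0 : 0 <= L * M by rewrite mulr_ge0// ltW.
apply: row_norm_le => [|i]; first by rewrite mulr_ge0// sqr_ge0.
have dY t : t \in `]0, s[ -> is_derive t 1 (fun r => Y x u v r 0 i) (b (Y x u v t) 0 i).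
  rewrite in_itv/= => /andP[t0 ts].
  by apply: is_derive_entry; apply: yd => //; [exact: nu|exact: nv].
have cYi : {within `[0, s], continuous (fun r => Y x u v r 0 i)}.
  move=> r; apply: (@cvg_comp _ _ _ (Y x u v) (fun w => w 0 i) _ (nbhs (Y x u v r))).
    exact: cY.
  exact: coord_continuous.
have [t] := MVT_segment (ltW s0) dY cYi.
rewrite in_itv/= subr0 => ts h; rewrite !mxE.
have -> : Y x u v s 0 i - (x 0 i + s * b x 0 i) = (b (Y x u v t) - b x) 0 i * s.
  rewrite opprD addrA; rewrite y0 in h; rewrite h !mxE; ring.
rewrite normrM (gtr0_norm s0) expr2 mulrA ler_wpM2r//; first exact: ltW.
rewrite (le_trans (ler_norm_entry _ _))// (le_trans (bL _ _))// -mulrA ler_wpM2l//.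
  exact: ltW.
rewrite (le_trans (norm_trajectory_before_le x u0 v0 ts))//.
by rewrite ler_wpM2l//; case/andP: ts.
Qed.

(** Several impulses cost at least as much as their sum made at time [s]: each is discounted no more
    than at [s], and [h] is subadditive. At least one impulse is required, as 0 need not belong to
    [S]. *)
Lemma paid_subadditive (S : set 'rV[R]_n) (w : control S) (h : 'rV[R]_n -> R) (p : nat -> bool) N s :
  (forall z, S z -> 0 <= h z) ->
  (forall z1 z2, S z1 -> S z2 -> S (z1 + z2)) ->
  (forall z1 z2, S z1 -> S z2 -> h (z1 + z2) <= h z1 + h z2) ->
  (0 < N)%N -> (forall m, (m < N)%N -> (itime w m <= s%:E)%E /\ p m) ->
  S (\sum_(0 <= m < N) isize w m) /\
  expR (- lam * s) * h (\sum_(0 <= m < N) isize w m) <= paid h lam w p N.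
Proof.
move=> h0 Sadd hadd + hw.
have one m : (m < N)%N -> S (isize w m) /\
    expR (- lam * s) * h (isize w m) <= h (isize w m) * expR (- lam * fine (itime w m)) * (p m)%:R.
  move=> mN; have [] := hw m mN; have := itime_ge0 w m.
  have Sm : itime w m <> +oo%E -> S (isize w m) by exact: isize_in.
  move: Sm; case: (itime w m) => [r| |]//= Sm _; rewrite lee_fin => rs ->.
  have {}Sm : S (isize w m) by exact: Sm.
  split => //; rewrite mulr1 mulrC ler_wpM2l ?h0// ler_expR !mulNr lerN2.
  by rewrite ler_wpM2l// ltW.
have : forall m, (m < N)%N -> S (\sum_(0 <= k < m.+1) isize w k) /\
    expR (- lam * s) * h (\sum_(0 <= k < m.+1) isize w k) <= paid h lam w p m.+1.
  elim=> [|m IH] mN.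
    by rewrite /paid !big_nat1; exact: one.
  have [S1 h1] := IH (ltnW mN); have [S2 h2] := one _ mN.
  rewrite /paid ![\sum_(0 <= _ < m.+2) _]big_nat_recr//=; split; first exact: Sadd.
  rewrite (@le_trans _ _ (expR (- lam * s) * (h (\sum_(0 <= k < m.+1) isize w k) + h (isize w m.+1))))//.
    by rewrite ler_wpM2l ?expR_ge0// hadd.
  by rewrite mulrDr lerD.
by case: N {hw one} => // N /(_ N (ltnSn N)).
Qed.

End small_times.

Section viscosity.
Context {R : realType} {n : nat} {U V : set 'rV[R]_n}.
Variables (b : 'rV[R]_n -> 'rV[R]_n) (f c chi : 'rV[R]_n -> R) (lam M L F K : R).
Hypotheses (lam0 : 0 < lam) (L0 : 0 < L) (K0 : 0 <= K) (bM : forall y, `|b y| <= M)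
  (bL : forall y z, `|b y - b z| <= L * `|y - z|)
  (fF : forall y, `|f y| <= F)
  (fK : forall y z, `|f y - f z| <= K * `|y - z|)
  (c0 : forall z, U z -> 0 <= c z) (chi0 : forall z, V z -> 0 <= chi z)
  (Uadd : forall z1 z2, U z1 -> U z2 -> U (z1 + z2))
  (Vadd : forall z1 z2, V z1 -> V z2 -> V (z1 + z2))
  (csub : forall z1 z2, U z1 -> U z2 -> c (z1 + z2) <= c z1 + c z2)
  (chisub : forall z1 z2, V z1 -> V z2 -> chi (z1 + z2) <= chi z1 + chi z2).
Notation Y := (trajectory b).
Notation G := (pgain b f c chi lam).
Implicit Types (u : control U) (v : control V) (x y xi eta : 'rV[R]_n) (s t : R).
Variable W : 'rV[R]_n -> R.
Hypothesis gvW : @game_value R n U V b f c chi lam F W.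

Let F0 : 0 <= F. Proof. exact: le_trans (fF 0). Qed.
Let M0 : 0 <= M. Proof. exact: le_trans (bM 0). Qed.

Lemma expR_linear s (a : R) : 0 <= s ->
  a - lam * `|a| * s <= expR (- lam * s) * a <= a + lam * `|a| * s.
Proof.
move=> s0; have lams : 0 <= lam * s by rewrite mulr_ge0// ltW.
have e1 : `|expR (- lam * s) - 1| <= lam * s.
  rewrite ler0_norm; last by rewrite subr_le0 expR_le1N.
  have /andP[h _] := expR_bounds lams; rewrite mulNr.
  by move: h; lra.
have : `|(expR (- lam * s) - 1) * a| <= lam * s * `|a| by rewrite normrM ler_wpM2r.
rewrite ler_norml => /andP[h1 h2].
by apply/andP; split; move: h1 h2; lra.
Qed.

Lemma near0_mul_le (A k : R) : 0 < k -> \forall s \near (0 : R)^'+, A * s <= k.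
Proof.
move=> k0; have A1 : 0 < `|A| + 1 by rewrite ltr_wpDl.
have kA : 0 < k / (`|A| + 1) by rewrite divr_gt0.
near=> s; have s0 : 0 < s by near: s; exact: nbhs_right_gt.
rewrite (@le_trans _ _ ((`|A| + 1) * s))//.
  by rewrite ler_pM2r// (le_trans (ler_norm A))// lerDl.
by rewrite mulrC -ler_pdivlMr//; near: s; exact: nbhs_right_le.
Unshelve. all: by end_near. Qed.

(** The impulses made before [s] may be arbitrarily large, so the state after them ranges over the
    whole space: a uniform modulus of continuity is used to neglect the drift. *)
Lemma value_after x u v s d (om : R) : 0 <= s -> M * s <= d ->
  (forall y z, `|y - z| <= d -> `|W y - W z| <= om) ->
  `|expR (- lam * s) * W (Y x u v s) - expR (- lam * s) * W (x + cum u v s)| <= om.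
Proof.
move=> s0 Ms hW; rewrite -mulrBr normrM ger0_norm ?expR_ge0//.
rewrite -[leRHS]mul1r ler_pM ?expR_ge0 ?expR_le1N// hW//.
exact: le_trans (trajectory_displacement L0 bM bL x u v s0) Ms.
Qed.

Lemma payoff_no_eta x u v s d (om : R) : 0 <= s -> M * s <= d ->
  (forall y z, `|y - z| <= d -> `|W y - W z| <= om) -> cnt v s = 0%N ->
  - F * s - paid c lam u (effective u v) (cnt u s)
    + expR (- lam * s) * W (x + \sum_(0 <= m < cnt u s) effsize u v m) - om <=
  G s x u v + expR (- lam * s) * W (Y x u v s).
Proof.
move=> s0 Ms hW v0; have := value_after x u v s0 Ms hW.
have := norm_flow_gain_le lam0 L0 bM bL fF fK x u v s0.
rewrite /pgain /cum v0 /paid [\sum_(0 <= k < 0) isize v k]big_geq//.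
rewrite [\sum_(0 <= k < 0) (_ * _)]big_geq// !addr0 !ler_norml.
by move=> /andP[h1 _] /andP[h2 _]; move: h1 h2; lra.
Qed.

(** All impulses of player-eta before [s] are merged into one. Their sum may be 0, so it is not
    treated as an impulse, only as a point of [V] in [H_inf]. *)
Lemma payoff_eta x u v s d (om : R) : 0 <= s -> M * s <= d ->
  (forall y z, `|y - z| <= d -> `|W y - W z| <= om) -> (0 < cnt v s)%N ->
  exists2 eta, V eta &
  - F * s - paid c lam u (effective u v) (cnt u s)
    + expR (- lam * s) * (chi eta + W (x + \sum_(0 <= m < cnt u s) effsize u v m + eta)) - om <=
  G s x u v + expR (- lam * s) * W (Y x u v s).
Proof.
move=> s0 Ms hW v0; have := value_after x u v s0 Ms hW.
have := norm_flow_gain_le lam0 L0 bM bL fF fK x u v s0.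
have vs m : (m < cnt v s)%N -> (itime v m <= s%:E)%E /\ xpredT m.
  by rewrite ltn_cnt => /ltW.
have [Veta h] := paid_subadditive lam0 chi0 Vadd chisub v0 vs.
rewrite /cum addrA /pgain !ler_norml => /andP[h1 _] /andP[h2 _].
exists (\sum_(0 <= k < cnt v s) isize v k) => //.
rewrite mulrDr; move: h h1 h2.
set p := paid c _ _ _ _; set q := paid chi _ _ _ _; set g := flow_gain _ _ _ _ _ _ _.
move: (_ * chi _) (_ * W (_ + _)) (_ * W _) p q g => p1 p2 p3 p q g; lra.
Qed.

Lemma cnt_no_impulse (S : set 'rV[R]_n) s : cnt (no_impulse : control S) s = 0%N.
Proof. by apply/eqP; rewrite -leqn0 leqNgt ltn_cnt. Qed.

Lemma payoff_xi x u s d (om : R) : 0 <= s -> M * s <= d ->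
  (forall y z, `|y - z| <= d -> `|W y - W z| <= om) -> (0 < cnt u s)%N ->
  exists2 xi, U xi &
  G s x u (no_impulse : control V)
    + expR (- lam * s) * W (Y x u (no_impulse : control V) s) <=
  F * s + expR (- lam * s) * (W (x + xi) - c xi) + om.
Proof.
move=> s0 Ms hW u0; set v := (no_impulse : control V).
have := value_after x u v s0 Ms hW.
have := norm_flow_gain_le lam0 L0 bM bL fF fK x u v s0.
have eff m : (m < cnt u s)%N -> effective u v m.
  by rewrite ltn_cnt => us; apply/asboolP => k /= uE; move: us; rewrite uE.
have us m : (m < cnt u s)%N -> (itime u m <= s%:E)%E /\ effective u v m.
  by move=> mN; split; [move: mN; rewrite ltn_cnt => /ltW|exact: eff].
have [Uxi h] := paid_subadditive lam0 c0 Uadd csub u0 us.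
have E : \sum_(0 <= m < cnt u s) effsize u v m = \sum_(0 <= m < cnt u s) isize u m.
  by apply: eq_big_nat => m /andP[_ mN]; rewrite /effsize eff// scale1r.
rewrite /cum /pgain cnt_no_impulse E [\sum_(0 <= k < 0) isize v k]big_geq//.
have -> : paid chi lam v xpredT 0 = 0 by rewrite /paid big_geq.
rewrite !addr0 !ler_norml => /andP[_ h1] /andP[_ h2].
exists (\sum_(0 <= m < cnt u s) isize u m) => //.
rewrite mulrBr; move: h h1 h2.
set p := paid c _ _ _ _; set g := flow_gain _ _ _ _ _ _ _.
move: (_ * c _) (_ * W (_ + _)) (_ * W _) p g => p1 p2 p3 p g; lra.
Qed.

(** Of the gap [k], one quarter absorbs the terms linear in [s] together with the tolerance
    [s ^+ 2], another the modulus of continuity. *)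
Let lin1 (w h lh s e om k g : R) : k = h - w -> 0 < k ->
  (F + 1 + lh) * s <= k / 4 -> om = k / 4 -> s ^+ 2 <= s ->
  h - lh * s <= e -> - F * s + e - om <= g -> w + s ^+ 2 < g.
Proof. by lra. Qed.

Lemma sqr_le_near0 : \forall s \near (0 : R)^'+, s ^+ 2 <= s.
Proof.
near=> s; have s0 : 0 < s by near: s; exact: nbhs_right_gt.
by rewrite expr2 ler_piMl ?ltW//; near: s; exact: nbhs_right_lt.
Unshelve. all: by end_near. Qed.

(** The real [h] stands for [H_inf], which may be [+oo]. The threshold on [s] does not depend on the
    controls. The last two conditions say that [u] has no effect before [s], either because it is
    inactive or because its impulse is cancelled; the conclusion then contradicts [gv_response]. *)
Lemma acting_suboptimal x (h : R) : (forall eta, V eta -> h <= W (x + eta) + chi eta) ->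
  W x < h -> \forall s \near (0 : R)^'+, forall u v, (0 < cnt v s)%N ->
    \sum_(0 <= m < cnt u s) effsize u v m = 0 ->
    paid c lam u (effective u v) (cnt u s) = 0 ->
    W x + s ^+ 2 < G s x u v + expR (- lam * s) * W (Y x u v s).
Proof.
move=> hh; rewrite -subr_gt0; set k := h - W x => k0.
have om0 : 0 < k / 4 by rewrite divr_gt0.
have [d d0 hW] := gv_uniform gvW om0.
near=> s => u v v0 u0 p0; have s0 : 0 < s by near: s; exact: nbhs_right_gt.
have Ms : M * s <= d by near: s; exact: near0_mul_le.
have [eta Veta] := payoff_eta x u (ltW s0) Ms hW v0.
rewrite u0 p0 addr0 subr0; apply: (@lin1 (W x) h (lam * `|h|) s _ (k / 4) k) => //.
- by near: s; exact: near0_mul_le.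
- by near: s; exact: sqr_le_near0.
- have /andP[h1 _] := expR_linear h (ltW s0); rewrite (le_trans h1)//.
  by rewrite ler_wpM2l ?expR_ge0// addrC hh.
Unshelve. all: by end_near. Qed.

Let lin2 (w a la s e om k g cx : R) : k = a - cx - w -> 0 < k ->
  (F + 1 + la) * s <= k / 4 -> om = k / 4 -> s ^+ 2 <= s ->
  a - la * s <= e -> - F * s - cx + e - om <= g -> w + s ^+ 2 < g.
Proof. by lra. Qed.

Lemma paid_pulse xi (Uxi : U xi) (xi0 : xi <> 0) (p : nat -> bool) :
  paid c lam (pulse Uxi xi0 no_impulse) p 1 = c xi * (p 0%N)%:R.
Proof. by rewrite /paid big_nat1/= mulr0 expR0 mulr1. Qed.

Lemma cnt_pulse xi (Uxi : U xi) (xi0 : xi <> 0) s : 0 < s ->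
  cnt (pulse Uxi xi0 no_impulse) s = 1%N.
Proof.
move=> s0; apply: eq_nat_ltn => -[|m]; rewrite ltn_cnt/= ?lte_fin ?s0 //.
Qed.

(** Player-xi jumps by [xi] at time 0. If that were profitable, every reply of player-eta, whether
    it cancels the jump, stays inactive or acts later, would leave more than [W x + s ^+ 2], against
    [gv_response]. The case [xi = 0], not an impulse, is separate. *)
Lemma supersolution_jump x (h : R) xi : (forall eta, V eta -> h <= W (x + eta) + chi eta) ->
  W x < h -> U xi -> W (x + xi) - c xi <= W x.
Proof.
move=> hh Wh Uxi; have [xi0|/eqP xi0] := eqVneq xi 0.
  by rewrite {1}xi0 addr0 lerBlDr lerDl; exact: c0.
rewrite leNgt -subr_gt0; set k := _ - _ - _; apply/negP => k0.
have om0 : 0 < k / 4 by rewrite divr_gt0.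
have [d d0 hW] := gv_uniform gvW om0.
have sub := acting_suboptimal hh Wh.
near (0 : R)^'+ => s; have s0 : 0 < s by near: s; exact: nbhs_right_gt.
have Ms : M * s <= d by near: s; exact: near0_mul_le.
pose u := pulse Uxi xi0 no_impulse.
have [v hv] := gv_response gvW x u (ltW s0) (exprn_gt0 2 s0).
have cu : cnt u s = 1%N by exact: cnt_pulse.
suff : W x + s ^+ 2 < G s x u v + expR (- lam * s) * W (Y x u v s) by rewrite ltNge hv.
have [e0|e0] := boolP (effective u v 0); last first.
  have v0 : (0 < cnt v s)%N.
    move/asboolPn/existsNP : e0 => [m /contrapT /= vm].
    by apply: (leq_ltn_trans (leq0n m)); rewrite ltn_cnt -vm lte_fin.
  have : forall u v, (0 < cnt v s)%N ->
    \sum_(0 <= m < cnt u s) effsize u v m = 0 ->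
    paid c lam u (effective u v) (cnt u s) = 0 ->
    W x + s ^+ 2 < G s x u v + expR (- lam * s) * W (Y x u v s) by near: s.
  apply => //; rewrite cu ?big_nat1 ?/effsize ?(negbTE e0) ?scale0r//.
  by rewrite paid_pulse (negbTE e0) mulr0.
have fin g : - F * s - c xi + expR (- lam * s) * W (x + xi) - k / 4 <= g -> W x + s ^+ 2 < g.
  apply: (@lin2 (W x) (W (x + xi)) (lam * `|W (x + xi)|) s _ (k / 4) k _ (c xi)) => //.
  - by near: s; exact: near0_mul_le.
  - by near: s; exact: sqr_le_near0.
  - by have /andP[] := expR_linear (W (x + xi)) (ltW s0).
have [v0|v0] := posnP (cnt v s).
  apply: fin; have := payoff_no_eta x u (ltW s0) Ms hW v0.
  by rewrite cu big_nat1 paid_pulse /effsize e0 scale1r mulr1.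
(* The jump goes through and player-eta acts later, before [s]: by [gv_pulse] at [x + xi], it gains
   nothing over inaction. *)
have [eta Veta] := payoff_eta x u (ltW s0) Ms hW v0.
rewrite cu big_nat1 paid_pulse /effsize e0 scale1r mulr1 => hG.
apply: fin; apply: le_trans hG; rewrite lerD2r lerD2l ler_wpM2l ?expR_ge0//.
by rewrite [leRHS]addrC; exact: (gv_pulse gvW).
Unshelve. all: by end_near. Qed.

Let C := (K * M + F * lam) + L * M.
Let C0 : 0 <= C.
Proof. by rewrite /C !addr_ge0// ?mulr_ge0// ltW. Qed.

Lemma quiet_expansion x u v s : 0 < s -> cnt u s = 0%N -> cnt v s = 0%N ->
  `|G s x u v - s * f x| <= C * s ^+ 2 /\ `|Y x u v s - (x + s *: b x)| <= C * s ^+ 2.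
Proof.
move=> s0 u0 v0; have s2 : 0 <= s ^+ 2 by exact: sqr_ge0.
split.
  rewrite /pgain u0 v0 /paid !big_geq// subr0 addr0.
  rewrite (le_trans (flow_gain_expansion lam0 L0 K0 bM bL fF fK x (ltW s0) u0 v0))//.
  by rewrite ler_wpM2r// lerDl mulr_ge0// ltW.
rewrite (le_trans (trajectory_expansion L0 bM bL x s0 u0 v0))// ler_wpM2r//.
by rewrite lerDr addr_ge0// mulr_ge0// ltW.
Qed.

Let lin3 (w g t e W' : R) : g + e * W' <= w + t -> - w <= - g + e * - W' + t.
Proof. by lra. Qed.
Let lin4 (g sf q : R) : - q <= g - sf -> - g <= - sf + q.
Proof. by lra. Qed.

(** Against an inactive player-xi, [acting_suboptimal] forces the near-optimal reply to be inactive
    before [s], so the state only follows the flow. *)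
Lemma supersolution_flow x (h : R) phi : (forall eta, V eta -> h <= W (x + eta) + chi eta) ->
  W x < h -> differentiable phi x -> W x = phi x ->
  (\forall z \near x, phi z <= W z) ->
  0 <= lam * W x - dotp (grad phi x) (b x) - f x.
Proof.
move=> hh Wh dphi Wphi near_phi.
have sub := acting_suboptimal hh Wh.
have : lam * (- W) x - dotp (grad (- phi) x) (b x) - (- f x) <= 0.
  apply: (@hj_limit R n _ _ x (b x) (- f x) lam C lam0 C0).
  - exact: differentiableN.
  - by rewrite -[LHS]/(- W x) Wphi.
  - by apply: (filterS _ near_phi) => z; rewrite -[(- W) z]/(- W z) lerN2.
  near=> s; have s0 : 0 < s by near: s; exact: nbhs_right_gt.
  pose u : control U := no_impulse.
  have [v hv] := gv_response gvW x u (ltW s0) (exprn_gt0 2 s0).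
  have u0 := cnt_no_impulse U s.
  have [v0|v0] := posnP (cnt v s); last first.
    suff : W x + s ^+ 2 < G s x u v + expR (- lam * s) * W (Y x u v s).
      by rewrite ltNge hv.
    have : forall u v, (0 < cnt v s)%N ->
      \sum_(0 <= m < cnt u s) effsize u v m = 0 ->
      paid c lam u (effective u v) (cnt u s) = 0 ->
      W x + s ^+ 2 < G s x u v + expR (- lam * s) * W (Y x u v s) by near: s.
    by apply => //; rewrite u0 /paid big_geq.
  have [h1 h2] := quiet_expansion x s0 u0 v0.
  exists (- G s x u v), (Y x u v s); split => //.
    exact: lin3.
  by rewrite mulrN; apply: lin4; move: h1; rewrite ler_norml => /andP[].
rewrite grad_opp// [dotp (- _) _](_ : _ = - dotp (grad phi x) (b x)).
  by rewrite -[(- W) x]/(- W x) mulrN; move: (dotp _ _) (f x) (lam * W x) => p q r; lra.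
by rewrite /dotp -sumrN; apply: eq_bigr => i _; rewrite mxE mulNr.
Unshelve. all: by end_near. Qed.

Let lin5 (w r la s e om k g : R) : k = w - r -> 0 < k ->
  (F + 1 + la) * s <= k / 4 -> om = k / 4 -> s ^+ 2 <= s ->
  e <= r + la * s -> g <= F * s + e + om -> w - s ^+ 2 <= g -> False.
Proof. by lra. Qed.
Let lin6 (w t g q : R) : w - t <= g + q -> w <= g + q + t.
Proof. by lra. Qed.
Let lin7 (g sf q : R) : g - sf <= q -> g <= sf + q.
Proof. by lra. Qed.

(** If the near-optimal control acted before [s], its merged impulses would yield at most [r] up to
    small errors, less than [W x]; so it is inactive there and only the flow remains. *)
Lemma subsolution_flow x (r : R) phi : (forall xi, U xi -> W (x + xi) - c xi <= r) ->
  r < W x -> differentiable phi x -> W x = phi x ->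
  (\forall z \near x, W z <= phi z) ->
  lam * W x - dotp (grad phi x) (b x) - f x <= 0.
Proof.
move=> hr; rewrite -subr_gt0; set k := W x - r => k0 dphi Wphi near_phi.
have om0 : 0 < k / 4 by rewrite divr_gt0.
have [d d0 hW] := gv_uniform gvW om0.
apply: (@hj_limit R n _ _ x (b x) (f x) lam C lam0 C0 dphi Wphi near_phi).
near=> s; have s0 : 0 < s by near: s; exact: nbhs_right_gt.
have [u hu] := gv_feedback gvW x (ltW s0) (exprn_gt0 2 s0).
have v0 := cnt_no_impulse V s.
set v := (no_impulse : control V) in hu v0.
have [u0|u0] := posnP (cnt u s).
  have [h1 h2] := quiet_expansion x s0 u0 v0.
  exists (G s x u v), (Y x u v s); split => //.
    exact: lin6.
  by apply: lin7; move: h1; rewrite ler_norml => /andP[].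
exfalso.
have Ms : M * s <= d by near: s; exact: near0_mul_le.
have [xi Uxi hxi] := payoff_xi x (ltW s0) Ms hW u0.
apply: (@lin5 (W x) r (lam * `|r|) s _ (k / 4) k _ erefl k0 _ erefl _ _ hxi hu).
- by near: s; exact: near0_mul_le.
- by near: s; exact: sqr_le_near0.
- have /andP[_ h1] := expR_linear r (ltW s0); rewrite (le_trans _ h1)//.
  by rewrite ler_wpM2l ?expR_ge0// hr.
Unshelve. all: by end_near. Qed.

Lemma gv_continuous : continuous W.
Proof.
move=> x; apply/(@cvgrPdist_le _ _ _ (nbhs (x : 'rV[R]_n))) => e e0.
have [d d0 hW] := gv_uniform gvW e0.
near=> y; apply: hW; near: y.
by apply: cvgr_dist_le => //; exact: cvg_id.
Unshelve. all: by end_near. Qed.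

Lemma gv_subsolution : viscosity_subsolution b f c chi lam U V W.
Proof.
split; first exact: gv_continuous.
move=> x phi [dphi _] Wphi max_x; rewrite /HJBI ge_max; apply/andP; split; last first.
  rewrite sube_le0; apply: le_ereal_inf_tmp => _ [eta Veta <-].
  by rewrite lee_fin; exact: (gv_pulse gvW).
rewrite ge_min; have [HW|WH] := ltP (H_sup c U W x) (W x)%:E; last first.
  by rewrite sube_le0 WH orbT.
(* If [U] is empty, [H_sup] is [-oo], and any real below [W x] will do. *)
have [r Hr rW] : exists2 r : R, (H_sup c U W x <= r%:E)%E & r < W x.
  case: (H_sup c U W x) HW => [r| |]//; first by rewrite lte_fin => ?; exists r.
  by move=> _; exists (W x - 1); rewrite ?leNye// gtrBl.
apply/orP; left; rewrite lee_fin; apply: (@subsolution_flow x r) => //.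
  move=> xi Uxi; rewrite -lee_fin (le_trans _ Hr)//; apply: ereal_sup_ubound.
  by exists xi.
by apply: filterS max_x => z; rewrite Wphi subrr subr_le0.
Qed.

Lemma gv_supersolution : viscosity_supersolution b f c chi lam U V W.
Proof.
split; first exact: gv_continuous.
move=> x phi [dphi _] Wphi min_x; rewrite /HJBI le_max.
have [HW|WH] := leP (H_inf chi V W x) (W x)%:E; first by rewrite subre_ge0// HW orbT.
(* If [V] is empty, [H_inf] is [+oo], and any real above [W x] will do. *)
have [h hH Wh] : exists2 h : R, (h%:E <= H_inf chi V W x)%E & W x < h.
  case: (H_inf chi V W x) WH => [h| |]//; first by rewrite lte_fin => ?; exists h.
  by move=> _; exists (W x + 1); rewrite ?leey// ltrDl.
have hh eta : V eta -> h <= W (x + eta) + chi eta.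
  move=> Veta; rewrite -lee_fin (le_trans hH)//; apply: ereal_inf_lbound.
  by exists eta.
apply/orP; left; rewrite le_min lee_fin (supersolution_flow hh)//=; last first.
  by apply: filterS min_x => z; rewrite Wphi subrr subr_ge0.
rewrite subre_ge0//; apply: ge_ereal_sup => _ [xi Uxi <-].
by rewrite lee_fin; exact: supersolution_jump hh Wh Uxi.
Qed.

End viscosity.

Lemma bounded_fun_le {T : Type} {R : realType} {N : normedModType R} (g : T -> N) :
  bounded_fun g -> exists M : R, forall x, `|g x| <= M.
Proof. by move=> [M [_ hM]]; exists (M + 1) => x; apply: hM => //; rewrite ltrDl. Qed.

(** The constant is made positive because the Picard estimates divide by it. *)
Lemma lipschitz_le {R : realType} {N1 N2 : normedModType R} (g : N1 -> N2) :
  lipschitz g -> exists2 L : R, 0 < L & forall x y, `|g x - g y| <= L * `|x - y|.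
Proof.
move=> [L [_ hL]]; exists (Num.max L 0 + 1); first by rewrite ltr_wpDl// le_max lexx orbT.
move=> x y; apply: (hL (Num.max L 0 + 1) _ (x, y)) => //.
by rewrite (@le_lt_trans _ _ (Num.max L 0)) ?le_max ?lexx// ltrDl.
Qed.




Theorem theorem3 (R : realType) (n : nat) (lam : R) (U V : set 'rV[R]_n)
    (b : 'rV[R]_n -> 'rV[R]_n) (f c chi : 'rV[R]_n -> R)
    (n_ge1 : (1 <= n)%N) (lam_gt0 : 0 < lam)
    (b_bounded : bounded_fun b) (b_lipschitz : lipschitz b)
    (f_bounded : bounded_fun f) (f_lipschitz : lipschitz f)
    (c_ge0 : forall xi, U xi -> 0 <= c xi)
    (chi_ge0 : forall eta, V eta -> 0 <= chi eta)
    (c_inf_gt0 : (0 < ereal_inf [set (c xi)%:E | xi in U])%E)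
    (chi_inf_gt0 : (0 < ereal_inf [set (chi eta)%:E | eta in V])%E)
    (U_add : forall xi1 xi2, U xi1 -> U xi2 -> U (xi1 + xi2))
    (V_add : forall eta1 eta2, V eta1 -> V eta2 -> V (eta1 + eta2))
    (c_subadd : forall xi1 xi2, U xi1 -> U xi2 ->
      c (xi1 + xi2) <= c xi1 + c xi2)
    (chi_subadd : forall eta1 eta2, V eta1 -> V eta2 ->
      chi (eta1 + eta2) < chi eta1 + chi eta2) :
  ((forall x, lower_value b f c chi lam U V x \is a fin_num) /\
   viscosity_solution b f c chi lam U V
     (fun x => fine (lower_value b f c chi lam U V x))) /\
  ((forall x, upper_value b f c chi lam U V x \is a fin_num) /\
   viscosity_solution b f c chi lam U V
     (fun x => fine (upper_value b f c chi lam U V x))).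
Proof.
have [M bM] := bounded_fun_le b_bounded; have [L L0 bL] := lipschitz_le b_lipschitz.
have [F fF] := bounded_fun_le f_bounded; have [K K0 fK] := lipschitz_le f_lipschitz.
have chisub z1 z2 (V1 : V z1) (V2 : V z2) := ltW (chi_subadd z1 z2 V1 V2).
have solution W : @game_value R n U V b f c chi lam F W ->
    viscosity_solution b f c chi lam U V W.
  move=> gvW; split; first exact: (gv_subsolution lam_gt0 L0 (ltW K0) bM bL fF fK).
  exact: (gv_supersolution lam_gt0 L0 (ltW K0) bM bL fF fK).
split.
  have [fin gvW] := @lower_game_value R n U V b f c chi lam M L F K
  lam_gt0 L0 bM bL fF fK c_ge0 chi_ge0.
  by split => //; exact: solution.
have [fin gvW] := @upper_game_value R n U V b f c chi lam M L F K
  lam_gt0 L0 bM bL fF fK c_ge0 chi_ge0.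
by split => //; exact: solution.
Qed.
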